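(* Consider the aggregation model $\partial_t\rho-\nabla\cdot(\rho\,\nabla K*\rho)=0$ on $\mathbb{H}^2$, with $K(x,y)=G(x,y)+A_m(d(x,y))$, $A_m=b_0A_c+b_1A_h$, and $b_0,b_1\ge0$ such that $(b_0,b_1)\ne(0,0)$. Then there exists a unique radially symmetric equilibrium in the form $$\tilde\rho_m(\theta)=\begin{cases} b_0+\left(\dfrac{1-2\pi b_0\alpha_{b_0b_1}}{\pi\alpha_{b_0b_1}(\alpha_{b_0b_1}+2)}\right)\cosh\theta & \text{if } 0\le\theta\le\cosh^{-1}(\alpha_{b_0b_1}+1),\\[8pt] 0 & \text{if } \theta>\cosh^{-1}(\alpha_{b_0b_1}+1),\end{cases}$$ where $\alpha_{b_0b_1}$ is a solution of the polynomial equation $$1-2\pi(b_0+b_1)x-2\pi b_1x^2-\frac{2\pi b_1}{3}x^3+\frac{\pi^2b_0b_1}{3}x^4=0.$$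
   Context: Hyperboloid model: $\mathbb{H}^2=\{x\in\mathbb{R}^3: -x_0^2+x_1^2+x_2^2=-1,\ x_0>0\}$, geodesic distance $d(x,y)=\cosh^{-1}(x_0y_0-x_1y_1-x_2y_2)$, vertex $v=(1,0,0)$, canonical volume measure $dx$ (equal to $\sinh\theta\,d\theta\,d\sigma$ in polar coordinates about $v$, $\theta=d(x,v)$). $G(x,y)=-\frac{1}{2\pi}\log\tanh\frac{d(x,y)}{2}$ is the Green's function of $-\Delta_{\mathbb{H}^2}$, i.e. $\Delta_xG(x,y)=-\delta_y$. In dimension $2$: $A_c(\theta)=\int_0^\theta\frac{\int_0^{s}\sinh\xi\,d\xi}{\sinh s}\,ds$ (so $\Delta_xA_c(d(x,y))=1$) and $A_h(\theta)=\frac{\cosh\theta-1}{2}$ (so $\Delta_xA_h(d(x,y))=\cosh d(x,y)$). $K*\rho(x)=\int_{\mathbb{H}^2}K(x,y)\rho(y)\,dy$. An equilibrium is a probability density $\rho\ge0$, $\int_{\mathbb{H}^2}\rho\,dx=1$, such that $\Lambda(x)=\int_{\mathbb{H}^2}K(x,y)\rho(y)\,dy$ is constant a.e. on $\operatorname{supp}(\rho)$; it satisfies $\rho(x)=\int_{\operatorname{supp}(\rho)}\Delta_xA_m(d(x,y))\rho(y)\,dy$ for $x\in\operatorname{supp}(\rho)$. A radially symmetric density is written $\rho(x)=\tilde\rho(d(v,x))$; the radially symmetric equilibria considered have as support a geodesic ball centred at $v$. *)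

(* Defs.v *)
From HB Require Import structures.
From mathcomp Require Import all_boot all_order all_algebra.
From mathcomp Require Import all_classical all_reals all_analysis measurable_realfun.
From mathcomp Require Import lra.

Set Implicit Arguments.
Unset Strict Implicit.
Unset Printing Implicit Defensive.

Import Order.TTheory GRing.Theory Num.Theory.
Import numFieldNormedType.Exports.

Local Open Scope classical_set_scope.
Local Open Scope ring_scope.

Section hyperbolic_functions.
Context {R : realType}.
Implicit Types t x : R.

Definition cosh t : R := (expR t + expR (- t)) / 2.
Definition sinh t : R := (expR t - expR (- t)) / 2.
Definition tanh t : R := sinh t / cosh t.

(* The inverse of cosh : [0, +oo[ -> [1, +oo[, see coshK and acoshK. *)
Definition acosh x : R := ln (x + Num.sqrt (x ^+ 2 - 1)).

Lemma sinh_ge0 t : 0 <= t -> 0 <= sinh t.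
Proof. by move=> t0; rewrite divr_ge0// subr_ge0 ler_expR; lra. Qed.

Lemma cosh2_sinh2 t : cosh t ^+ 2 - sinh t ^+ 2 = 1.
Proof.
have h : expR t * expR (- t) = 1 by rewrite -expRD subrr expR0.
by rewrite /cosh /sinh; nra.
Qed.

Lemma coshK t : 0 <= t -> acosh (cosh t) = t.
Proof.
move=> t0; rewrite /acosh.
have -> : cosh t ^+ 2 - 1 = sinh t ^+ 2 by have := cosh2_sinh2 t; lra.
rewrite sqrtr_sqr ger0_norm ?sinh_ge0//.
have -> : cosh t + sinh t = expR t by rewrite /cosh /sinh; lra.
by rewrite expRK.
Qed.

Lemma acoshK x : 1 <= x -> cosh (acosh x) = x.
Proof.
move=> x1; rewrite /acosh; set s := Num.sqrt _.
have s0 : 0 <= s by exact: sqrtr_ge0.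
have s2 : s ^+ 2 = x ^+ 2 - 1 by rewrite sqr_sqrtr//; nra.
have xs : 0 < x + s by lra.
rewrite /cosh expRN lnK ?posrE//.
have -> : (x + s)^-1 = x - s.
  by apply: (mulfI (lt0r_neq0 xs)); rewrite divff ?gt_eqF//; nra.
lra.
Qed.

Lemma measurable_cosh : measurable_fun setT cosh.
Proof.
apply: measurable_funM => //; apply: measurable_funD => //.
exact: measurableT_comp.
Qed.

Lemma measurable_sinh : measurable_fun setT sinh.
Proof.
apply: measurable_funM => //; apply: measurable_funB => //.
exact: measurableT_comp.
Qed.

End hyperbolic_functions.

Section hyperboloid.
Context {R : realType}.
Implicit Types x y : R * R * R.

Definition H2 : set (R * R * R) :=
  [set x | - x.1.1 ^+ 2 + x.1.2 ^+ 2 + x.2 ^+ 2 = -1 /\ 0 < x.1.1].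

Definition vertex : R * R * R := (1, 0, 0).

Definition hdist x y : R :=
  acosh (x.1.1 * y.1.1 - x.1.2 * y.1.2 - x.2 * y.2).

Definition polar (p : R * R) : R * R * R :=
  (cosh p.1, sinh p.1 * cos p.2, sinh p.1 * sin p.2).

Definition polar_domain : set (R * R) :=
  `[0, +oo[%classic `*` `[0, 2 * pi[%classic.

(* The volume sinh theta dtheta dsigma of the hyperboloid, seen as a Borel
   measure on the ambient space that is carried by H2. *)
Definition hvol (A : set (R * R * R)) : \bar R :=
  (\int[lebesgue_measure \x lebesgue_measure]_(p in polar_domain `&` polar @^-1` A)
     (sinh p.1)%:E)%E.

Lemma measurable_polar : measurable_fun setT polar.
Proof.
have mc : measurable_fun setT (@cos R).
  by apply: continuous_measurable_fun; exact: continuous_cos.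
have ms : measurable_fun setT (@sin R).
  by apply: continuous_measurable_fun; exact: continuous_sin.
have msh := @measurable_sinh R.
apply: measurable_fun_pair; first apply: measurable_fun_pair.
- by apply: measurableT_comp => //; exact: measurable_cosh.
- by apply: measurable_funM; exact: measurableT_comp.
- by apply: measurable_funM; exact: measurableT_comp.
Qed.

Lemma measurable_polar_domain : measurable polar_domain.
Proof. exact: measurableX. Qed.

Let hvol0 : hvol set0 = 0%E.
Proof. by rewrite /hvol preimage_set0 setI0 integral_set0. Qed.

Let hvol_ge0 A : (0 <= hvol A)%E.
Proof.
apply: integral_ge0 => -[t s] [[/= + _] _].
by rewrite in_itv/= andbT lee_fin => /sinh_ge0.
Qed.

Let hvol_sigma_additive : semi_sigma_additive hvol.
Proof.
move=> /= F mF tF mUF; rewrite {2}/hvol.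
have -> : polar_domain `&` polar @^-1` (\bigcup_n F n) =
          \bigcup_n (polar_domain `&` polar @^-1` F n).
  by rewrite preimage_bigcup setI_bigcupr.
rewrite ge0_integral_bigcup//=.
- apply: is_cvg_ereal_nneg_natsum_cond => // n _ _; exact: hvol_ge0.
- move=> n; apply: measurableI; first exact: measurable_polar_domain.
  by rewrite -[X in measurable X]setTI; exact: measurable_polar.
- apply: measurable_funTS; apply/measurable_EFinP.
  exact: measurableT_comp measurable_sinh _.
- move=> -[t s] [n _ [[/= + _] _]].
  by rewrite in_itv/= andbT lee_fin => /sinh_ge0.
- apply/trivIsetP => i j _ _ ij.
  rewrite setIACA setIid -preimage_setI.
  by move/trivIsetP : tF => /(_ _ _ Logic.I Logic.I ij) ->;
    rewrite preimage_set0 setI0.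
Qed.

HB.instance Definition _ := isMeasure.Build _ _ _ hvol
  hvol0 hvol_ge0 hvol_sigma_additive.

(* The support of the measure rho dx, for the geodesic topology. *)
Definition hsupp (rho : R * R * R -> R) : set (R * R * R) :=
  [set x | H2 x /\ forall e : R, 0 < e ->
    (0 < hvol [set y | [/\ H2 y, hdist x y < e & rho y != 0]%R])%E].

(* On the diagonal, a null set, this is 0 instead of +oo because ln 0 = 0. *)
Definition green x y : R := - (2 * pi)^-1 * ln (tanh (hdist x y / 2)).

Definition A_c (theta : R) : R :=
  \int[lebesgue_measure]_(s in `[0, theta])
    ((\int[lebesgue_measure]_(xi in `[0, s]) sinh xi) / sinh s).

Definition A_h (theta : R) : R := (cosh theta - 1) / 2.

Definition A_m (b0 b1 theta : R) : R := b0 * A_c theta + b1 * A_h theta.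

Definition Kpot (b0 b1 : R) x y : R := green x y + A_m b0 b1 (hdist x y).

(* As Kpot >= 0, this is well defined in [0, +oo] whenever rho >= 0. *)
Definition Lambda (b0 b1 : R) (rho : R * R * R -> R) x : \bar R :=
  (\int[hvol]_(y in H2) (Kpot b0 b1 x y * rho y)%:E)%E.

Definition prob_density (rho : R * R * R -> R) : Prop :=
  [/\ measurable_fun H2 rho,
      forall x, H2 x -> 0 <= rho x &
      (\int[hvol]_(x in H2) (rho x)%:E = 1)%E].

Definition equilibrium (b0 b1 : R) (rho : R * R * R -> R) : Prop :=
  prob_density rho /\
  exists c : R,
    {ae hvol, forall x, hsupp rho x -> Lambda b0 b1 rho x = c%:E}.

Definition radially_symmetric (rho : R * R * R -> R) : Prop :=
  exists rhot : R -> R, forall x, H2 x -> rho x = rhot (hdist vertex x).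

Definition ball_supported (rho : R * R * R -> R) : Prop :=
  exists2 r : R, 0 < r &
    hsupp rho = [set x | H2 x /\ hdist vertex x <= r].

Definition radial_equilibrium (b0 b1 : R) (rho : R * R * R -> R) : Prop :=
  [/\ equilibrium b0 b1 rho, radially_symmetric rho & ball_supported rho].

Definition rhot_m (b0 alpha theta : R) : R :=
  if theta <= acosh (alpha + 1) then
    b0 + (1 - 2 * pi * b0 * alpha) / (pi * alpha * (alpha + 2)) * cosh theta
  else 0.

End hyperboloid.

(* Main.v *)
Require Import Defs.
From mathcomp Require Import all_boot all_order all_algebra.
From mathcomp Require Import all_classical all_reals all_analysis.
From mathcomp Require Import measurable_realfun ring lra.
Import Order.TTheory GRing.Theory Num.Theory.
Import numFieldNormedType.Exports.
Set Implicit Arguments.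
Unset Strict Implicit.
Unset Printing Implicit Defensive.
Local Open Scope classical_set_scope.
Local Open Scope ring_scope.

(** Let [u] be the hyperbolic cosine of the distance of two points, which is
    minus their Lorentz product. The kernel is
    [- ln ((u - 1) / (u + 1)) / (4 pi) + b0 ln ((1 + u) / 2) + b1 (u - 1) / 2].
    Along a circle centred at the vertex, [u] is a trigonometric polynomial of
    degree one, so the means of the logarithms follow from the mean value property
    of [ln |1 - q z|] on the unit disc (the lemma Rintegral_ln_poisson, proved by
    the functional equation [J q = J (q ^ 2) / 2] of the mean [J]). Hence the mean
    of the kernel over a circle is explicit, and the Green function satisfies
    Newton's theorem (integral_Kpot_polar).

    For a radial density [f] with support of radius [r], let [M t] be the mass in
    the ball of radius [t] and [m] the integral of [cosh] against the density.
    By Newton's theorem and an exchange of integrals, the potential at distance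
    [t] is, up to a constant,
    [(integral over [t, r] of M s / (2 pi sinh s)) + b0 ln ((1 + cosh t) / 2)
    + b1 m cosh t / 2] (integral_Kmean). It is constant for [0 < t < r] exactly
    when its derivative vanishes, i.e. when
    [M t = 2 pi (b0 (cosh t - 1) + beta (cosh t ^ 2 - 1) / 2)] with
    [beta = b1 m], and this means [f t = b0 + beta cosh t] for almost all [t].
    The total mass is [1] when, with [alpha = cosh r - 1],
    [beta = (1 - 2 pi b0 alpha) / (pi alpha (alpha + 2))]; the polynomial
    equation in [alpha] then expresses the self-consistency [beta = b1 m].

    Existence runs this computation backwards from a root [alpha] with
    [beta >= 0] (rho_radial_equilibrium). For uniqueness, the potential is
    continuous and equals a constant at almost every point of the support, so
    that it can be differentiated; the density is recovered from [M] by the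
    Lebesgue differentiation theorem. Since [beta = b1 m >= 0], the value of
    [alpha] satisfies [2 pi b0 alpha <= 1], and the polynomial is decreasing in
    that range, so it has exactly one root there (radius_poly_inj); roots
    violating this bound do not correspond to equilibria. *)

(** * Hyperbolic functions *)

Section hyperbolic_facts.
Context {R : realType}.
Implicit Types t s u e : R.

Lemma cosh0 : cosh 0 = 1 :> R.
Proof. by rewrite /cosh oppr0 expR0 -mulr2n -mulr_natr mul1r divff. Qed.

Lemma sinh0 : sinh 0 = 0 :> R.
Proof. by rewrite /sinh oppr0 subrr mul0r. Qed.

Lemma cosh_gt0 t : 0 < cosh t.
Proof. by rewrite divr_gt0// addr_gt0// expR_gt0. Qed.

Lemma cosh_ge1 t : 1 <= cosh t.
Proof. by have := cosh2_sinh2 t; have := cosh_gt0 t; nra. Qed.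

Lemma sinh_gt0 t : 0 < t -> 0 < sinh t.
Proof. by move=> t0; rewrite divr_gt0// subr_gt0 ltr_expR; lra. Qed.

Lemma ler_sinh s t : s <= t -> sinh s <= sinh t.
Proof.
move=> st; have : expR s <= expR t by rewrite ler_expR.
have : expR (- t) <= expR (- s) by rewrite ler_expR lerN2.
by rewrite /sinh; lra.
Qed.

Lemma coshB s t : cosh (s - t) = cosh s * cosh t - sinh s * sinh t.
Proof.
by rewrite /cosh /sinh opprB (addrC t) !expRD; field.
Qed.

Lemma coshN t : cosh (- t) = cosh t.
Proof. by rewrite /cosh opprK addrC. Qed.

Lemma sinhN t : sinh (- t) = - sinh t.
Proof. by rewrite /sinh opprK -mulNr opprB. Qed.

Lemma cosh_half t : cosh t = 2 * cosh (t / 2) ^+ 2 - 1.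
Proof.
have -> : cosh t = cosh (t / 2 - - (t / 2)) by rewrite opprK -splitr.
by rewrite coshB coshN sinhN; have := cosh2_sinh2 (t / 2); lra.
Qed.

Lemma is_derive_cosh t : is_derive t 1 (@cosh R) (sinh t).
Proof.
rewrite /cosh /sinh; apply: is_derive_eq.
by rewrite /GRing.scale/=; field.
Qed.

Lemma is_derive_sinh t : is_derive t 1 (@sinh R) (cosh t).
Proof.
rewrite /cosh /sinh; apply: is_derive_eq.
by rewrite /GRing.scale/=; field.
Qed.

Lemma continuous_cosh : continuous (@cosh R).
Proof.
move=> t; apply/differentiable_continuous/derivable1_diffP.
by have [] := is_derive_cosh t.
Qed.

Lemma continuous_sinh : continuous (@sinh R).
Proof.
move=> t; apply/differentiable_continuous/derivable1_diffP.
by have [] := is_derive_sinh t.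
Qed.

Lemma ltr_cosh : {in Num.nneg &, {mono (@cosh R) : s t / s < t}}.
Proof.
apply: leW_mono_in; apply: le_mono_in => s t; rewrite !nnegrE => s0 t0 st.
suff : 0 < (cosh t - cosh s) by rewrite subr_gt0.
have -> : cosh t - cosh s =
    (expR t - expR s) * (1 - expR (- (s + t))) / 2.
  have ht : expR t * (expR (- s) * expR (- t)) = expR (- s).
    by rewrite mulrCA expRxMexpNx_1 mulr1.
  have hs : expR s * (expR (- s) * expR (- t)) = expR (- t).
    by rewrite mulrA expRxMexpNx_1 mul1r.
  by rewrite opprD expRD /cosh; lra.
by rewrite divr_gt0// mulr_gt0// subr_gt0 ?ltr_expR// expR_lt1 oppr_lt0; lra.
Qed.

Lemma ler_cosh : {in Num.nneg &, {mono (@cosh R) : s t / s <= t}}.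
Proof.
by move=> s t s0 t0; rewrite !leNgt ltr_cosh.
Qed.

Lemma cosh_inj : {in Num.nneg &, injective (@cosh R)}.
Proof.
move=> s t s0 t0 /eqP; rewrite eq_le !ler_cosh// => /andP[st ts].
by apply/eqP; rewrite eq_le st ts.
Qed.

Lemma cosh_max s t : 0 <= s -> 0 <= t ->
  cosh (Num.max s t) = Num.max (cosh s) (cosh t).
Proof.
move=> s0 t0; have [st|/ltW st] := leP s t.
  by rewrite max_r// ler_cosh.
by rewrite max_l// ler_cosh.
Qed.

Lemma cosh_gt1 t : 0 < t -> 1 < cosh t.
Proof. by move=> t0; rewrite -cosh0 ltr_cosh ?nnegrE// ltW. Qed.

Lemma acosh_ge0 u : 1 <= u -> 0 <= acosh u.
Proof.
move=> u1; apply: ln_ge0; have := sqrtr_ge0 (u ^+ 2 - 1); lra.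
Qed.

Lemma sinh_acosh2 u : 1 <= u -> sinh (acosh u) ^+ 2 = u ^+ 2 - 1.
Proof.
by move=> u1; have := cosh2_sinh2 (acosh u); rewrite acoshK//; lra.
Qed.

(** [tanh (d / 2) ^+ 2] is a rational function of [cosh d], also at [d = 0]
    by the convention [ln 0 = 0]. *)
Lemma ln_tanh_half t : 0 <= t ->
  ln (tanh (t / 2)) = ln ((cosh t - 1) / (cosh t + 1)) / 2.
Proof.
rewrite le_eqVlt => /predU1P[<-|t0].
  by rewrite cosh0 subrr !mul0r /tanh sinh0 mul0r ln0// mul0r.
have c0 := cosh_gt0 (t / 2).
have s0 : 0 < sinh (t / 2) by rewrite sinh_gt0// divr_gt0.
have th0 : 0 < tanh (t / 2) by rewrite divr_gt0.
have -> : (cosh t - 1) / (cosh t + 1) = tanh (t / 2) ^+ 2.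
  have h := cosh2_sinh2 (t / 2).
  rewrite /tanh expr_div_n cosh_half.
  have -> : 2 * cosh (t / 2) ^+ 2 - 1 - 1 = 2 * sinh (t / 2) ^+ 2 by lra.
  by rewrite subrK -mulf_div divff ?mul1r// pnatr_eq0.
by rewrite lnXn// -(mulr_natr (ln _)) mulfK.
Qed.

End hyperbolic_facts.
(** * The hyperboloid *)

Section hyperboloid_facts.
Context {R : realType}.
Implicit Types x y : R * R * R.

(** The opposite of the Lorentz form, which on the hyperboloid is the
    hyperbolic cosine of the distance. *)
Definition lform x y : R := x.1.1 * y.1.1 - x.1.2 * y.1.2 - x.2 * y.2.

Lemma H2_fst_ge1 x : H2 x -> 1 <= x.1.1.
Proof. by move=> [xE x0]; nra. Qed.

Lemma lform_vertex x : lform vertex x = x.1.1.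
Proof. by rewrite /lform /vertex/=; lra. Qed.

Lemma hdist_vertex x : hdist vertex x = acosh x.1.1.
Proof. by rewrite -[in RHS](lform_vertex x). Qed.

Lemma hdist_vertex_ge0 x : H2 x -> 0 <= hdist vertex x.
Proof. by move=> /H2_fst_ge1 x1; rewrite hdist_vertex acosh_ge0. Qed.

Lemma cosh_hdist_vertex x : H2 x -> cosh (hdist vertex x) = x.1.1.
Proof. by move=> /H2_fst_ge1 x1; rewrite hdist_vertex acoshK. Qed.

(** The triangle inequality for [vertex], [x] and [y], by the Cauchy-Schwarz
    inequality. *)
Lemma cosh_hdistB_le x y : H2 x -> H2 y ->
  cosh (hdist vertex x - hdist vertex y) <= lform x y.
Proof.
move=> Hx Hy; have := H2_fst_ge1 Hx; have := H2_fst_ge1 Hy => y1 x1.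
rewrite coshB !cosh_hdist_vertex// !hdist_vertex.
have sx : 0 <= sinh (acosh x.1.1) by rewrite sinh_ge0// acosh_ge0.
have sy : 0 <= sinh (acosh y.1.1) by rewrite sinh_ge0// acosh_ge0.
have sx2 := sinh_acosh2 x1; have sy2 := sinh_acosh2 y1.
set a := sinh _ in sx sx2 *; set b := sinh _ in sy sy2 *.
have [xE _] := Hx; have [yE _] := Hy.
rewrite /lform; suff : x.1.2 * y.1.2 + x.2 * y.2 <= a * b by lra.
have ab0 : 0 <= a * b by exact: mulr_ge0.
apply: le_trans (ler_norm _) _.
rewrite -(ler_pXn2r (_ : 0 < 2)%N) ?nnegrE// real_normK ?num_real//.
have -> : (a * b) ^+ 2 = (x.1.2 ^+ 2 + x.2 ^+ 2) * (y.1.2 ^+ 2 + y.2 ^+ 2).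
  by rewrite exprMn sx2 sy2; congr (_ * _); lra.
by have := sqr_ge0 (x.1.2 * y.2 - x.2 * y.1.2); nra.
Qed.

Lemma lform_ge1 x y : H2 x -> H2 y -> 1 <= lform x y.
Proof.
by move=> Hx Hy; exact: le_trans (cosh_ge1 _) (cosh_hdistB_le Hx Hy).
Qed.

Lemma hdist_ge0 x y : H2 x -> H2 y -> 0 <= hdist x y.
Proof. by move=> Hx Hy; exact/acosh_ge0/lform_ge1. Qed.

Lemma cosh_hdist x y : H2 x -> H2 y -> cosh (hdist x y) = lform x y.
Proof. by move=> Hx Hy; exact/acoshK/lform_ge1. Qed.

Lemma hdist_lt x y e : H2 x -> H2 y -> 0 <= e ->
  (hdist x y < e) = (lform x y < cosh e).
Proof.
by move=> Hx Hy e0; rewrite -cosh_hdist// ltr_cosh ?nnegrE// hdist_ge0.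
Qed.

Lemma polar_H2 (p : R * R) : H2 (polar p).
Proof.
split; rewrite /polar/= ?cosh_gt0//.
have csh := cosh2_sinh2 p.1.
rewrite -addrA [(_ * cos _) ^+ 2]exprMn [(_ * sin _) ^+ 2]exprMn -mulrDr.
by rewrite cos2Dsin2; lra.
Qed.

Lemma hdist_vertex_polar (p : R * R) : 0 <= p.1 -> hdist vertex (polar p) = p.1.
Proof. by move=> p0; rewrite hdist_vertex coshK. Qed.

(** At the vertex every angle fits, and [0] is chosen; elsewhere the angle is
    [acos] of the first coordinate direction or its reflection, according to the
    sign of the second one. *)
Lemma polar_surj x : H2 x ->
  exists2 s, 0 <= s < 2 * pi & x = polar (hdist vertex x, s).
Proof.
move=> Hx; have x1 := H2_fst_ge1 Hx; have [xE _] := Hx.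
have c := cosh_hdist_vertex Hx; have t0 := hdist_vertex_ge0 Hx.
set t := hdist vertex x in c t0 *.
have p0 := pi_gt0 R.
have [tp|] := ltP 0 t; last first.
  move=> t0'; have tE : t = 0 by apply/eqP; rewrite eq_le t0 t0'.
  exists 0; first by rewrite lexx/=; lra.
  rewrite /polar/= tE sinh0 !mul0r cosh0; rewrite tE cosh0 in c.
  have : x.1.2 ^+ 2 + x.2 ^+ 2 = 0 by rewrite -c in xE; lra.
  move=> /eqP; rewrite paddr_eq0 ?sqr_ge0// !sqrf_eq0 => /andP[/eqP h1 /eqP h2].
  by rewrite (surjective_pairing x) (surjective_pairing x.1) -c h1 h2.
have [sh shE] : exists sh, sinh t = sh by exists (sinh t).
have st := sinh_gt0 tp; rewrite shE in st.
have sh2 : x.1.2 ^+ 2 + x.2 ^+ 2 = sh ^+ 2.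
  by have := cosh2_sinh2 t; rewrite shE c; lra.
have [q1 q2] : x.1.2 = sh * (x.1.2 / sh) /\ x.2 = sh * (x.2 / sh).
  by split; rewrite mulrCA divff ?mulr1// gt_eqF.
set a := x.1.2 / sh in q1; set b := x.2 / sh in q2.
have ab : a ^+ 2 + b ^+ 2 = 1.
  by rewrite /a /b !expr_div_n -mulrDl sh2 divff// expf_neq0// gt_eqF.
have a1 : -1 <= a <= 1 by apply/andP; split; nra.
have [r [rb rc rs]] :
    exists r, [/\ 0 <= r < 2 * pi, cos r = a & sin r = b].
  have h := sin_acos a1; have [b0|b0] := leP 0 b.
  - exists (acos a); split; rewrite ?acosK// ?h//.
      rewrite acos_ge0//=; apply: le_lt_trans (acos_lepi a1) _; lra.
    by rewrite (_ : 1 - a ^+ 2 = b ^+ 2) ?sqrtr_sqr ?ger0_norm//; lra.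
  - exists (2 * pi - acos a).
    have aK := acosK a1.
    have -> : 2 * pi - acos a = - acos a + pi *+ 2 by rewrite mulr2n; lra.
    rewrite cosD2pi sinD2pi cosN sinN h aK; split => //; last first.
      by rewrite (_ : 1 - a ^+ 2 = b ^+ 2) ?sqrtr_sqr ?ltr0_norm ?opprK//; lra.
    have := acos_lepi a1; have : 0 < acos a.
      by apply: acos_gt0; have [-> _ /=] := andP a1; nra.
    rewrite mulr2n; lra.
exists r => //; rewrite /polar/= shE rc rs -q1 -q2 c.
by rewrite -!surjective_pairing.
Qed.

Lemma lform_polar x (p : R * R) :
  lform x (polar p) =
  x.1.1 * cosh p.1 - sinh p.1 * (x.1.2 * cos p.2 + x.2 * sin p.2).
Proof. by rewrite /lform /polar/=; ring. Qed.

End hyperboloid_facts.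
(** * Integrals over a period *)

Section circle_integrals.
Context {R : realType}.
Notation mu := (@lebesgue_measure R).
Implicit Types (G : R -> R) (a b k l p r s t : R).

Lemma continuous_integrable G a b : continuous G ->
  mu.-integrable `[a, b] (EFin \o G).
Proof.
move=> cG; apply: continuous_compact_integrable; first exact: segment_compact.
exact: continuous_subspaceT.
Qed.

Lemma Rintegral_affine G a b k l : continuous G -> a <= b -> 0 < k ->
  \int[mu]_(x in `[k * a + l, k * b + l]) G x =
  k * \int[mu]_(x in `[a, b]) G (k * x + l).
Proof.
move=> cG ab k0; pose F x := k * x + l.
have dF (x : R) : is_derive x (1 : R) F k.
  by rewrite /F; apply: is_derive_eq; rewrite /GRing.scale/=; ring.
have F'E : F^`()%classic = cst k.
  by apply/funext => x; rewrite derive1E; apply: derive_val.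
have cF : continuous F.
  move=> x; apply/differentiable_continuous/derivable1_diffP.
  by have [] := dF x.
have cGF : continuous (G \o F).
  by move=> x; apply: continuous_comp; [exact: cF|exact: cG].
rewrite -RintegralZl//; last exact: continuous_integrable.
rewrite /Rintegral; congr fine.
rewrite (@integration_by_substitution_increasing _ F)//.
- by apply: eq_integral => x _ /=; rewrite F'E/= mulrC.
- by move=> x y _ _ xy; rewrite /F ltrD2r ltr_pM2l.
- by rewrite F'E => x _; exact: cvg_cst.
- by rewrite F'E; exact: is_cvg_cst.
- by rewrite F'E; exact: is_cvg_cst.
- split; first by move=> x _; have [] := dF x.
  + exact/cvg_at_right_filter/cF.
  + exact/cvg_at_left_filter/cF.
- exact: continuous_subspaceT.
Qed.

Lemma Rintegral_split G a b c : mu.-integrable `[a, c] (EFin \o G) ->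
  a <= b -> b <= c ->
  \int[mu]_(x in `[a, c]) G x =
  \int[mu]_(x in `[a, b]) G x + \int[mu]_(x in `[b, c]) G x.
Proof.
move=> iG ab bc.
rewrite -[X in _ = _ + X]Rintegral_itv_obnd_cbnd; last first.
  apply: integrableS iG => //; apply: (@subset_trans _ `[b, c]).
    exact: subset_itv_oc_cc.
  exact: subset_itvr.
rewrite -(@Rintegral_itvB _ G (BLeft a) (BRight c) b iG) ?bnd_simp//.
by rewrite addrC subrK.
Qed.

Lemma Rintegral_period_half G : continuous G ->
  \int[mu]_(x in `[0, 2 * pi]) G x =
  \int[mu]_(x in `[0, pi]) (G x + G (x + pi)).
Proof.
move=> cG; have p0 := pi_gt0 R.
have cGp : continuous (fun x => G (x + pi)).
  move=> x; apply: (@continuous_comp _ _ _ (fun x => x + pi) G); last exact: cG.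
  by apply: continuousD => //; exact: cst_continuous.
rewrite (@Rintegral_split _ _ pi); [|exact: continuous_integrable|lra|lra].
rewrite RintegralD//; [|exact: continuous_integrable..].
congr (_ + _); have := @Rintegral_affine G 0 pi 1 pi cG (ltW p0) ltr01.
rewrite mulr0 add0r !mul1r (_ : pi + pi = 2 * pi); last by lra.
by under [in RHS]eq_Rintegral do rewrite mul1r.
Qed.

Lemma Rintegral_cos_sin p r :
  \int[mu]_(x in `[0, 2 * pi]) (p * cos x + r * sin x) = 0.
Proof.
have c : continuous (fun x : R => p * cos x + r * sin x).
  move=> x; apply: cvgD; apply: cvgM; (try exact: cvg_cst);
    [exact: continuous_cos|exact: continuous_sin].
rewrite Rintegral_period_half//.
under eq_Rintegral => x _.
  rewrite cosDpi sinDpi (_ : _ + _ = 0); last by ring.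
  over.
by rewrite Rintegral_cst// mul0r.
Qed.

(** [poisson p r t] is [|1 - q e^(i t)| ^ 2] where [q] is the complex number
    [p - i r]. *)
Definition poisson p r t : R :=
  1 + p ^+ 2 + r ^+ 2 - 2 * (p * cos t + r * sin t).

Lemma cos_sin_le p r t : (p * cos t + r * sin t) ^+ 2 <= p ^+ 2 + r ^+ 2.
Proof.
have := cos2Dsin2 t; set c := cos t; set s := sin t => cs.
have -> : p ^+ 2 + r ^+ 2 = (p ^+ 2 + r ^+ 2) * (c ^+ 2 + s ^+ 2).
  by rewrite cs mulr1.
by have := sqr_ge0 (p * s - r * c); nra.
Qed.

Lemma poisson_bounds p r t : p ^+ 2 + r ^+ 2 < 1 ->
  (1 - (p ^+ 2 + r ^+ 2)) ^+ 2 / 4 <= poisson p r t <= 4.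
Proof.
rewrite /poisson; have := cos_sin_le p r t.
set L := p * cos t + _; set q := _ + _ => Lq q1.
have q0 : 0 <= q by rewrite addr_ge0// sqr_ge0.
have -> : 1 + p ^+ 2 + r ^+ 2 = 1 + q by rewrite /q addrA.
have L1 : L <= 1 by nra.
have L2 : -1 <= L by nra.
apply/andP; split; last by lra.
(* the product of [1 + q - 2 L] and [1 + q + 2 L] is at least [(1 - q) ^ 2] *)
have h : (1 - q) ^+ 2 <= (1 + q - 2 * L) * (1 + q + 2 * L) by nra.
have h0 : 0 <= 1 + q - 2 * L by nra.
nra.
Qed.

Lemma poisson_gt0 p r t : p ^+ 2 + r ^+ 2 < 1 -> 0 < poisson p r t.
Proof.
move=> pr; have /andP[h _] := poisson_bounds t pr; apply: lt_le_trans h.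
by rewrite divr_gt0// exprn_gt0// subr_gt0.
Qed.

Lemma continuous_poisson p r : continuous (poisson p r).
Proof.
move=> x; apply: cvgB; first exact: cvg_cst.
apply: cvgM; first exact: cvg_cst.
apply: cvgD; apply: cvgM; (try exact: cvg_cst);
  [exact: continuous_cos|exact: continuous_sin].
Qed.

Lemma continuous_ln_comp (h : R -> R) : continuous h -> (forall x, 0 < h x) ->
  continuous (fun x => ln (h x)).
Proof.
move=> ch h0 x; apply: (@continuous_comp _ _ _ h (@ln R)); first exact: ch.
exact: continuous_ln.
Qed.

Lemma poisson_double p r t :
  poisson p r t * poisson p r (t + pi) =
  poisson (p ^+ 2 - r ^+ 2) (2 * p * r) (2 * t).
Proof.
rewrite /poisson cosDpi sinDpi (mulr_natl t 2) cos_mulr2n sin_mulr2n.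
rewrite -(mulr_natl (cos t ^+ 2) 2) -(mulr_natl (_ * sin t) 2).
have := cos2Dsin2 t; set c := cos t; set s := sin t => cs.
apply/eqP; rewrite -subr_eq0.
rewrite (_ : _ - _ = 4 * r ^+ 2 * (1 - (c ^+ 2 + s ^+ 2))); last by ring.
by rewrite cs subrr mulr0.
Qed.

Lemma poisson_double_le p r : p ^+ 2 + r ^+ 2 < 1 ->
  (p ^+ 2 - r ^+ 2) ^+ 2 + (2 * p * r) ^+ 2 <= p ^+ 2 + r ^+ 2.
Proof.
move=> pr; have -> : (p ^+ 2 - r ^+ 2) ^+ 2 + (2 * p * r) ^+ 2 =
  (p ^+ 2 + r ^+ 2) ^+ 2 by ring.
by have := sqr_ge0 p; have := sqr_ge0 r; nra.
Qed.

(** The functional equation [J q = J (q ^ 2) / 2] of the logarithmic mean. *)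
Lemma Rintegral_ln_poisson_double p r : p ^+ 2 + r ^+ 2 < 1 ->
  \int[mu]_(x in `[0, 2 * pi]) ln (poisson p r x) =
  (\int[mu]_(x in `[0, 2 * pi])
     ln (poisson (p ^+ 2 - r ^+ 2) (2 * p * r) x)) / 2.
Proof.
move=> pr; have p0 := pi_gt0 R.
have pr2 := le_lt_trans (poisson_double_le pr) pr.
have c1 := continuous_ln_comp (@continuous_poisson p r)
  (fun x => poisson_gt0 x pr).
have c2 := continuous_ln_comp (@continuous_poisson _ _)
  (fun x => poisson_gt0 x pr2).
rewrite Rintegral_period_half//.
have := @Rintegral_affine _ 0 pi 2 0 c2 (ltW p0) (ltr0Sn _ _).
rewrite mulr0 !addr0 => ->; rewrite mulrC mulKf//.
apply: eq_Rintegral => x _; rewrite addr0 -poisson_double.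
by rewrite lnM// posrE poisson_gt0.
Qed.

(** The mean over the circle of [ln |1 - q z| ^ 2], which is harmonic in [q] on
    the unit disc, is its value at [q = 0]. *)
Lemma Rintegral_ln_poisson p r : p ^+ 2 + r ^+ 2 < 1 ->
  \int[mu]_(x in `[0, 2 * pi]) ln (poisson p r x) = 0.
Proof.
set q := p ^+ 2 + r ^+ 2 => q1.
pose B := - ln ((1 - q) ^+ 2 / 4).
have m0 : 0 < (1 - q) ^+ 2 / 4 by rewrite divr_gt0// exprn_gt0// subr_gt0.
have q0 : 0 <= q by rewrite addr_ge0// sqr_ge0.
have bnd n : forall p' r', p' ^+ 2 + r' ^+ 2 <= q ->
    `|\int[mu]_(x in `[0, 2 * pi]) ln (poisson p' r' x)| <=
    2 * pi * B / 2 ^+ n.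
  elim: n => [|n IHn] p' r' pr'; last first.
    have pr1 := le_lt_trans pr' q1.
    rewrite Rintegral_ln_poisson_double// normrM (_ : `|2^-1| = 2^-1 :> R).
      rewrite [2 ^+ n.+1]exprSr invfM mulrA ler_pM2r ?invr_gt0//.
      exact/IHn/(le_trans (poisson_double_le pr1)).
    by rewrite ger0_norm// invr_ge0.
  have pr1 := le_lt_trans pr' q1.
  have c1 := continuous_ln_comp (@continuous_poisson p' r')
    (fun x => poisson_gt0 x pr1).
  have p0 := pi_gt0 R.
  rewrite expr0 divr1; apply: le_trans (le_normr_Rintegral _ _) _ => //.
    exact: continuous_integrable.
  have -> : 2 * pi * B = \int[mu]_(x in `[0, 2 * pi]) B.
    rewrite Rintegral_cst//= lebesgue_measure_itv/= lte_fin ifT ?mulr_gt0//=.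
    by rewrite subr0 mulrC.
  apply: le_Rintegral => //.
  - apply: continuous_integrable => x.
    by apply: cvg_norm; exact: c1.
  - by apply: continuous_integrable; exact: cst_continuous.
  move=> x _; have /andP[h1 h2] := poisson_bounds x pr1.
  have h3 : (1 - q) ^+ 2 / 4 <= poisson p' r' x.
    apply: le_trans h1; rewrite ler_pM2r ?invr_gt0//.
    rewrite ler_pXn2r ?nnegrE ?subr_ge0 ?(ltW pr1) ?(ltW q1)//; lra.
  have h4 : 0 < poisson p' r' x by exact: lt_le_trans h3.
  rewrite ler_norml /B opprK ler_ln ?posrE// h3/= -lnV ?posrE// ler_ln ?posrE//.
    apply: le_trans h2 _; rewrite invf_div ler_pdivlMr ?exprn_gt0 ?subr_gt0//.
    by nra.
  by rewrite invr_gt0.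
apply/eqP; rewrite -normr_eq0 eq_le normr_ge0 andbT.
apply/ler_addgt0Pl => e e0; rewrite addr0.
have B0 : 0 <= 2 * pi * B.
  by have := bnd 0%N p r (lexx _); rewrite expr0 divr1; apply: le_trans.
near \oo => n; apply: le_trans (bnd n p r (lexx _)) _.
rewrite ler_pdivrMr ?exprn_gt0// -ler_pdivrMl//.
apply: (@le_trans _ _ n%:R).
  by near: n; exact: nbhs_infty_ger.
by rewrite -natrX ler_nat ltnW// ltn_expl.
Unshelve. all: by end_near. Qed.

(** Mean over the circle of the logarithm of a trigonometric polynomial
    [a - (p cos t + r sin t)], with [a] parametrized as
    [(m ^ 2 + (p ^ 2 + r ^ 2) / 4) / m]. *)
Lemma Rintegral_ln_circle m p r : 0 < m -> p ^+ 2 + r ^+ 2 < (2 * m) ^+ 2 ->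
  \int[mu]_(x in `[0, 2 * pi])
    ln (m + (p ^+ 2 + r ^+ 2) / (4 * m) - (p * cos x + r * sin x)) =
  2 * pi * ln m.
Proof.
move=> m0 pr; pose P := p / (2 * m); pose Q := r / (2 * m).
have m20 : 0 < 2 * m by rewrite mulr_gt0.
have PQ : P ^+ 2 + Q ^+ 2 < 1.
  by rewrite /P /Q !expr_div_n -mulrDl ltr_pdivrMr ?mul1r// exprn_gt0.
have E x : m + (p ^+ 2 + r ^+ 2) / (4 * m) - (p * cos x + r * sin x) =
    m * poisson P Q x.
  by rewrite /poisson /P /Q; field; rewrite gt_eqF.
have cP := continuous_ln_comp (@continuous_poisson P Q)
  (fun x => poisson_gt0 x PQ).
under eq_Rintegral => x _.
  rewrite E lnM ?posrE ?poisson_gt0//.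
  over.
rewrite RintegralD//; last 2 first.
- by apply: continuous_integrable; exact: cst_continuous.
- exact: continuous_integrable.
rewrite Rintegral_ln_poisson// addr0 Rintegral_cst//= lebesgue_measure_itv/=.
have p0 := pi_gt0 R.
by rewrite lte_fin ifT ?mulr_gt0//= subr0 mulrC.
Qed.

End circle_integrals.
(** * Integration in polar coordinates *)

Section integral_density.
Context d d' (T : measurableType d) (S : measurableType d') {R : realType}.
Variables (mu : {measure set T -> \bar R}) (nu : {measure set S -> \bar R}).
Variables (D : set T) (phi : T -> S) (g : T -> R).
Hypotheses (mD : measurable D) (mphi : measurable_fun setT phi).
Hypotheses (mg : measurable_fun setT g) (g0 : forall x, D x -> 0 <= g x).
Hypothesis nuE : forall A, measurable A ->
  nu A = (\int[mu]_(x in D `&` phi @^-1` A) (g x)%:E)%E.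

Local Open Scope ereal_scope.
Import HBNNSimple.

Let mgE : measurable_fun D (EFin \o g).
Proof. by apply: measurable_funTS; apply/measurable_EFinP. Qed.

Let integral_density_nnsfun (f : {nnsfun S >-> R}) :
  \int[nu]_x (f x)%:E = \int[mu]_(x in D) ((f (phi x))%:E * (g x)%:E).
Proof.
under [LHS]eq_integral do rewrite fimfunE -fsumEFin//.
rewrite [LHS]ge0_integral_fsum//; last 2 first.
- by move=> r; exact/measurable_EFinP/measurableT_comp.
- by move=> n x _; rewrite EFinM nnfun_muleindic_ge0.
under [RHS]eq_integral.
  move=> x xD; rewrite fimfunE -fsumEFin// ge0_mule_fsuml; last first.
    by move=> r; rewrite EFinM nnfun_muleindic_ge0.
  over.
have mi r : measurable_fun D (fun x => (r * \1_(f @^-1` [set r]) (phi x))%:E).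
  apply: measurable_funTS; apply/measurable_EFinP.
  by do 2 apply: measurableT_comp => //.
rewrite [RHS]ge0_integral_fsum//; last 2 first.
- by move=> r; apply: emeasurable_funM.
- move=> n x Dx; rewrite mule_ge0 ?lee_fin ?g0//.
  by have := @nnfun_muleindic_ge0 _ _ _ f n (phi x); rewrite -EFinM lee_fin.
apply: eq_fsbigr => r _.
rewrite integralZl_indic_nnsfun//= integral_indic// setIT nuE//.
have [r0|r0] := ltP r 0%R.
  rewrite preimage_nnfun0// preimage_set0 setI0 integral_set0 mule0.
  by rewrite integral0_eq// => x _; rewrite indicE in_set0 mulr0 mul0e.
under [RHS]eq_integral do rewrite EFinM -muleA.
rewrite ge0_integralZl//; last first.
- by move=> x Dx; rewrite mule_ge0// lee_fin ?g0.
- apply: emeasurable_funM => //.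
  apply: measurable_funTS; apply/measurable_EFinP.
  by apply: measurableT_comp => //.
congr (_ * _); rewrite integral_mkcondr; apply: eq_integral => x _.
rewrite patchE indicE.
have -> : (x \in phi @^-1` (f @^-1` [set r])) = (phi x \in f @^-1` [set r]).
  by apply/idP/idP; rewrite !inE.
by case: ifPn; rewrite ?mul1e ?mul0e.
Qed.

(** Change of variables for a measure that is the image by [phi] of the
    measure with density [g] on [D]. *)
Lemma ge0_integral_density (f : S -> \bar R) :
  measurable_fun setT f -> (forall x, 0 <= f x) ->
  \int[nu]_x f x = \int[mu]_(x in D) (f (phi x) * (g x)%:E).
Proof.
move=> mf f0; pose f_ := nnsfun_approx measurableT mf.
transitivity (lim (\int[nu]_x (f_ n x)%:E @[n --> \oo])).
  rewrite -monotone_convergence//=.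
  - apply: eq_integral => x _; apply/esym/cvg_lim => //=.
    exact: cvg_nnsfun_approx.
  - by move=> n; exact/measurable_EFinP/measurable_funTS.
  - by move=> n ? _; rewrite lee_fin.
  - by move=> ? _ ? ? mn; rewrite lee_fin; exact/lefP/nd_nnsfun_approx.
rewrite [RHS](_ : _ = lim
    (\int[mu]_(x in D) ((f_ n (phi x))%:E * (g x)%:E) @[n --> \oo]));
    last first.
  rewrite -monotone_convergence//=.
  - apply: eq_integral => x /[!inE] xD; apply/esym/cvg_lim => //.
    by apply: cvgeZr => //; exact: cvg_nnsfun_approx.
  - move=> n; apply: emeasurable_funM => //; apply/measurable_EFinP.
    by apply: measurable_funTS; exact: measurableT_comp.
  - by move=> n x Dx; rewrite mule_ge0 ?lee_fin ?g0.
  - move=> x Dx a b ab; rewrite lee_wpmul2r ?lee_fin ?g0//.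
    exact/lefP/nd_nnsfun_approx.
by under eq_fun do rewrite integral_density_nnsfun.
Qed.

End integral_density.

Section polar_integration.
Context {R : realType}.
Notation mu := (@lebesgue_measure R).
Local Open Scope ereal_scope.

Lemma measurable_H2 : measurable (H2 : set (R * R * R)).
Proof.
have -> : H2 = (fun x : R * R * R => - x.1.1 ^+ 2 + x.1.2 ^+ 2 + x.2 ^+ 2)%R
      @^-1` [set (-1)%R] `&` (fun x : R * R * R => x.1.1) @^-1` `]0%R, +oo[.
  by apply/seteqP; split => x; rewrite /H2/= in_itv/= andbT.
have m11 : measurable_fun setT (fun x : R * R * R => x.1.1).
  exact: measurableT_comp.
have m12 : measurable_fun setT (fun x : R * R * R => x.1.2).
  exact: measurableT_comp.
have m2 : measurable_fun setT (fun x : R * R * R => x.2).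
  exact: measurable_snd.
apply: measurableI; rewrite -[X in measurable X]setTI; last exact: m11.
suff : measurable_fun setT
    (fun x : R * R * R => - x.1.1 ^+ 2 + x.1.2 ^+ 2 + x.2 ^+ 2)%R.
  by apply => //; exact: measurable_set1.
apply: measurable_funD; first apply: measurable_funD.
- by apply: measurableT_comp => //; exact: measurable_funX.
- exact: measurable_funX.
- exact: measurable_funX.
Qed.

Lemma hvolE (A : set (R * R * R)) : measurable A ->
  hvol A = \int[mu \x mu]_(p in polar_domain `&` polar @^-1` A) (sinh p.1)%:E.
Proof. by []. Qed.

(** The circle is parametrized by the closed interval [[0, 2 pi]], on which
    continuous functions are integrable. *)
Lemma ge0_integral_H2 (F : R * R * R -> \bar R) :
  measurable_fun H2 F -> (forall x, H2 x -> 0 <= F x) ->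
  \int[hvol]_(x in H2) F x =
  \int[mu]_(t in `[0%R, +oo[)
    ((sinh t)%:E * \int[mu]_(s in `[0%R, (2 * pi)%R]) F (polar (t, s))).
Proof.
move=> mF F0.
have mF' : measurable_fun setT (F \_ H2).
  by apply/(measurable_restrictT _ measurable_H2).
have F'0 x : 0 <= (F \_ H2) x.
  by rewrite patchE; case: ifPn => // /set_mem; exact: F0.
have F'polar p : (F \_ H2) (polar p) = F (polar p).
  by rewrite patchE mem_set//; exact: polar_H2.
have msh : measurable_fun setT (fun p : R * R => sinh p.1).
  exact: measurableT_comp measurable_sinh _.
have sh0 (p : R * R) : polar_domain p -> (0 <= sinh p.1)%R.
  by move=> [/= + _]; rewrite in_itv/= andbT => /sinh_ge0.
rewrite integral_mkcond.
rewrite (ge0_integral_density (mu := (mu \x mu)%E)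
  (measurable_polar_domain (R := R)) (measurable_polar (R := R)) msh sh0 hvolE)//.
under eq_integral do rewrite F'polar.
rewrite integral_mkcond.
pose G := (fun p : R * R => F (polar p) * (sinh p.1)%:E) \_ polar_domain.
have mG : measurable_fun setT G.
  have mP := @measurable_polar_domain R; apply/(measurable_restrictT _ mP).
  apply: measurable_funTS.
  apply: emeasurable_funM; last exact/measurable_EFinP.
  rewrite (_ : (fun p => F (polar p)) = (F \_ H2) \o polar); last first.
    by apply/funext => p /=; rewrite F'polar.
  exact: measurableT_comp mF' (@measurable_polar R).
have G0 p : 0 <= G p.
  rewrite /G patchE; case: ifPn => // /set_mem pp.
  by rewrite mule_ge0 ?lee_fin ?sh0// F0//; exact: polar_H2.
transitivity (\int[mu]_t fubini_F mu G t).
  exact: (fubini_tonelli1 (m1 := mu) (m2 := mu) G mG G0).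
rewrite [RHS]integral_mkcond.
apply: eq_integral => t _; rewrite /fubini_F patchE.
case: ifPn => [/set_mem tD|/negP tD]; last first.
  rewrite integral0_eq// => s _; rewrite /G patchE ifN//.
  by apply/negP => /set_mem[/= h _]; apply: tD; exact/mem_set.
have mFt : measurable_fun setT (fun s => F (polar (t, s))).
  rewrite (_ : (fun s => _) = (F \_ H2) \o polar \o pair t); last first.
    by apply/funext => p /=; rewrite F'polar.
  apply: measurableT_comp; last exact: measurable_pair1.
  exact: measurableT_comp mF' (@measurable_polar R).
rewrite -ge0_integralZl//; last 3 first.
- exact: measurable_funTS.
- by move=> s _; rewrite F0//; exact: polar_H2.
- by have := tD; rewrite /= in_itv/= andbT lee_fin => /sinh_ge0.
rewrite -integral_itv_bndo_bndc; last first.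
  apply: emeasurable_funM => //; exact: measurable_funTS.
rewrite [RHS]integral_mkcond; apply: eq_integral => s _.
rewrite /G !patchE muleC.
have -> : ((t, s) \in polar_domain) = (s \in `[0%R, (2 * pi)%R[%classic).
  by apply/idP/idP => /set_mem h; apply/mem_set => //; case: h.
by [].
Qed.

End polar_integration.
(** * The interaction kernel and its circular means *)

Section kernel.
Context {R : realType}.
Notation mu := (@lebesgue_measure R).
Implicit Types (b c r s t u : R).

Lemma Rintegral_FTC (F f : R -> R) a b : a <= b ->
  (forall x, a <= x <= b -> is_derive x (1 : R) F (f x)) ->
  (forall x, a <= x <= b -> {for x, continuous f}) ->
  \int[mu]_(x in `[a, b]) f x = F b - F a.
Proof.
rewrite le_eqVlt => /predU1P[<- _ _|ab dF cf].
  by rewrite set_itv1 Rintegral_set1 subrr.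
have cF x : a <= x <= b -> {for x, continuous F}.
  move=> abx; apply/differentiable_continuous/derivable1_diffP.
  by have [] := dF x abx.
rewrite /Rintegral (@continuous_FTC2 _ f F)//.
- by apply: continuous_in_subspaceT => x; rewrite inE/= in_itv; exact: cf.
- split.
  + move=> x; rewrite in_itv/= => /andP[ax xb].
    by have [] := dF x; rewrite ?ltW.
  + by apply/cvg_at_right_filter/cF; rewrite lexx ltW.
  + by apply/cvg_at_left_filter/cF; rewrite lexx ltW.
- move=> x; rewrite in_itv/= => /andP[ax xb]; rewrite derive1E.
  by apply: derive_val; apply: dF; rewrite !ltW.
Qed.

Lemma Rintegral_sinh s : 0 <= s -> \int[mu]_(t in `[0, s]) sinh t = cosh s - 1.
Proof.
move=> s0.
by rewrite (Rintegral_FTC s0 (fun x _ => is_derive_cosh x)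
  (fun x _ => @continuous_sinh R x)) cosh0.
Qed.

(** [A_c], as a function of the hyperbolic cosine of the distance. *)
Definition lmean c : R := ln ((1 + c) / 2).

(** The Green function, as a function of the hyperbolic cosine of the
    distance. *)
Definition gform c : R := - (4 * pi)^-1 * ln ((c - 1) / (c + 1)).

(** The derivative of [A_c], written so as to be continuous at [0]. *)
Definition dlmean t : R := sinh t / (1 + cosh t).

Lemma is_derive_lmean_cosh t :
  is_derive t (1 : R) (fun s => lmean (cosh s)) (dlmean t).
Proof.
have c0 := cosh_gt0 t; pose h s : R := (1 + cosh s) / 2.
have h0 : 0 < h t by rewrite divr_gt0//; lra.
have dc := is_derive_cosh t; have dl := is_derive1_ln h0.
have dh : is_derive t (1 : R) h (sinh t / 2).
  by apply: is_derive_eq; rewrite /GRing.scale/=; field.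
have := @is_derive1_comp _ (@ln R) h t _ _ dl dh.
suff -> : (h t)^-1 * (sinh t / 2) = dlmean t by [].
rewrite /dlmean /h; field.
by rewrite gt_eqF//; have := cosh_gt0 t; lra.
Qed.

Lemma continuous_dlmean : continuous dlmean.
Proof.
move=> t; apply: cvgM; first exact: continuous_sinh.
apply: cvgV; first by rewrite gt_eqF//; have := cosh_gt0 t; lra.
by apply: cvgD; [exact: cvg_cst|exact: continuous_cosh].
Qed.

Lemma A_cE t : 0 <= t -> A_c t = lmean (cosh t).
Proof.
move=> t0; rewrite /A_c; transitivity (\int[mu]_(s in `[0, t]) dlmean s).
  apply: eq_Rintegral => s; rewrite inE/= in_itv/= => /andP[s0 _].
  rewrite Rintegral_sinh//; move: s0; rewrite le_eqVlt => /predU1P[<-|s0].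
    by rewrite /dlmean sinh0 cosh0 subrr !mul0r.
  have sh : sinh s != 0 by rewrite gt_eqF// sinh_gt0.
  have ch : 1 + cosh s != 0 by rewrite gt_eqF// addr_gt0// cosh_gt0.
  apply/eqP; rewrite /dlmean eqr_div//.
  by apply/eqP; have := cosh2_sinh2 s; lra.
rewrite (Rintegral_FTC t0 (fun x _ => is_derive_lmean_cosh x)
  (fun x _ => @continuous_dlmean x)).
rewrite cosh0 [X in _ - X](_ : _ = 0) ?subr0// /lmean.
by rewrite (_ : (1 + 1) / 2 = 1) ?ln1//; lra.
Qed.

Implicit Types x y : R * R * R.

(** The interaction kernel, as a function of the hyperbolic cosine of the
    distance. *)
Definition Kform b0 b1 u : R := gform u + b0 * lmean u + b1 * ((u - 1) / 2).

Lemma Kpot_lform b0 b1 x y : H2 x -> H2 y ->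
  Kpot b0 b1 x y = Kform b0 b1 (lform x y).
Proof.
move=> Hx Hy; rewrite /Kpot /green /A_m /A_h A_cE ?hdist_ge0//.
rewrite ln_tanh_half ?hdist_ge0// cosh_hdist// /Kform /gform addrA.
congr (_ + _ + _); set l := ln _.
by have := pi_gt0 R; move: (@pi R) => q q0; field; rewrite gt_eqF.
Qed.

Lemma gform_ge0 c : 1 <= c -> 0 <= gform c.
Proof.
move=> c1; rewrite /gform mulNr oppr_ge0 mulr_ge0_le0//.
  by rewrite invr_ge0 mulr_ge0// pi_ge0.
by apply: ln_le0; rewrite ler_pdivrMr; lra.
Qed.

Lemma lmean_ge0 c : 1 <= c -> 0 <= lmean c.
Proof. by move=> c1; apply: ln_ge0; lra. Qed.

Lemma Kform_ge0 b0 b1 u : 0 <= b0 -> 0 <= b1 -> 1 <= u -> 0 <= Kform b0 b1 u.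
Proof.
move=> b00 b10 u1; rewrite !addr_ge0 ?gform_ge0// mulr_ge0 ?lmean_ge0//; lra.
Qed.

Lemma measurable_gform d (T : measurableType d) (D : set T) (h : T -> R) :
  measurable_fun D h -> (forall z, D z -> 1 <= h z) ->
  measurable_fun D (gform \o h).
Proof.
move=> mh h1; apply: measurable_funM; first exact: measurable_cst.
have mh1 (a : R) : measurable_fun D (fun z => h z + a).
  by apply: measurable_funD.
apply: (eq_measurable_fun
    (fun z => ln ((h z - 1) * expR (- ln (h z + 1))))).
  move=> z /set_mem Dz /=; rewrite expRN lnK// posrE.
  by have := h1 z Dz; lra.
apply: measurableT_comp; first exact: measurable_ln.
apply: measurable_funM; first exact: mh1.
apply: measurableT_comp => //; apply: measurableT_comp => //.
by apply: measurableT_comp => //; exact: measurable_ln.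
Qed.

Lemma measurable_lmean d (T : measurableType d) (D : set T) (h : T -> R) :
  measurable_fun D h -> measurable_fun D (lmean \o h).
Proof.
move=> mh; have m : measurable_fun D (fun z => (1 + h z) / 2).
  by apply: measurable_funM => //; apply: measurable_funD.
exact: (measurableT_comp (@measurable_ln R) m).
Qed.

Lemma measurable_lform x : measurable_fun H2 (lform x).
Proof.
apply: measurable_funTS; apply: measurable_funB; first apply: measurable_funB.
- by apply: measurable_funM => //; exact: measurableT_comp.
- by apply: measurable_funM => //; exact: measurableT_comp.
- by apply: measurable_funM => //; exact: measurable_snd.
Qed.

Lemma measurable_Kpot b0 b1 x : H2 x -> measurable_fun H2 (Kpot b0 b1 x).
Proof.
move=> Hx; apply: (eq_measurable_fun (Kform b0 b1 \o lform x)).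
  by move=> y /set_mem Hy /=; rewrite Kpot_lform.
have ml := measurable_lform x.
apply: measurable_funD; first apply: measurable_funD.
- by apply: measurable_gform => // y; exact: lform_ge1.
- by apply: measurable_funM => //; exact: measurable_lmean.
- apply: measurable_funM => //; apply: measurable_funM => //.
  exact: measurable_funB.
Qed.

(** Mean of the kernel over the circle of radius [acosh c'] centred at the
    vertex, seen from a point at distance [acosh c] of the vertex. The Green
    function obeys Newton's theorem: a circle acts on the outside as if its mass
    were at the centre, and creates a constant potential inside. *)
Definition Kmean b0 b1 c c' : R :=
  gform (Num.max c c') + b0 * (lmean c + lmean c') + b1 * ((c * c' - 1) / 2).

Lemma Kmean_ge0 b0 b1 c c' : 0 <= b0 -> 0 <= b1 -> 1 <= c -> 1 <= c' ->
  0 <= Kmean b0 b1 c c'.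
Proof.
move=> b00 b10 c1 c1'; rewrite !addr_ge0//.
- by rewrite gform_ge0// le_max c1.
- by rewrite mulr_ge0// addr_ge0// lmean_ge0.
- by rewrite mulr_ge0//; nra.
Qed.

Lemma measurable_Kmean b0 b1 c (D : set R) : 1 <= c ->
  measurable_fun D (fun t => Kmean b0 b1 c (cosh t)).
Proof.
move=> c1; have mc : measurable_fun D (@cosh R).
  by apply: measurable_funTS; exact: measurable_cosh.
apply: measurable_funD; first apply: measurable_funD.
- apply: (measurable_gform (h := fun t => Num.max c (cosh t))).
    by apply: measurable_maxr => //; exact: measurable_cst.
  by move=> t _; rewrite le_max c1.
- apply: measurable_funM => //; apply: measurable_funD => //.
  exact: measurable_lmean.
- apply: measurable_funM => //; apply: measurable_funM => //.
  by apply: measurable_funB => //; apply: measurable_funM.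
Qed.

(** Circular means of the two logarithms in the kernel, for two points at
    distances [acosh M] and [acosh m] of the vertex. *)
Lemma Rintegral_ln_circle2 M m p r : 1 <= m -> m < M ->
  p ^+ 2 + r ^+ 2 = (M ^+ 2 - 1) * (m ^+ 2 - 1) ->
  \int[mu]_(s in `[0, 2 * pi]) ln (m * M - 1 - (p * cos s + r * sin s)) =
    2 * pi * ln ((M - 1) * (m + 1) / 2) /\
  \int[mu]_(s in `[0, 2 * pi]) ln (m * M + 1 - (p * cos s + r * sin s)) =
    2 * pi * ln ((M + 1) * (m + 1) / 2).
Proof.
move=> m1 mM pr; split.
- have k0 : 0 < (M - 1) * (m + 1) / 2 by rewrite divr_gt0// mulr_gt0//; lra.
  rewrite -(@Rintegral_ln_circle _ _ p r)//; last first.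
    rewrite pr -subr_gt0 (_ : _ - _ = 2 * (M - m) * ((M - 1) * (m + 1))).
      by rewrite !mulr_gt0//; lra.
    by field.
  apply: eq_Rintegral => s _; congr (ln (_ - _)); rewrite pr.
  by field; apply/andP; split; rewrite gt_eqF//; lra.
- have k0 : 0 < (M + 1) * (m + 1) / 2 by rewrite divr_gt0// mulr_gt0//; lra.
  rewrite -(@Rintegral_ln_circle _ _ p r)//; last first.
    rewrite pr -subr_gt0 (_ : _ - _ = 2 * (M + m) * ((M + 1) * (m + 1))).
      by rewrite !mulr_gt0//; lra.
    by field.
  apply: eq_Rintegral => s _; congr (ln (_ - _)); rewrite pr.
  by field; apply/andP; split; rewrite gt_eqF//; lra.
Qed.

Lemma continuous_cos_sin p r : continuous (fun s : R => p * cos s + r * sin s).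
Proof.
move=> x; apply: cvgD; apply: cvgM; (try exact: cvg_cst);
  [exact: continuous_cos|exact: continuous_sin].
Qed.

Lemma continuous_integralE (G : R -> R) a b : continuous G ->
  (\int[mu]_(s in `[a, b]) (G s)%:E = (\int[mu]_(s in `[a, b]) G s)%:E)%E.
Proof.
move=> cG; rewrite /Rintegral fineK//; apply: integrable_fin_num => //.
exact: continuous_integrable.
Qed.

Lemma integral_Kpot_polar b0 b1 x t : H2 x -> 0 <= t -> cosh t != x.1.1 ->
  (\int[mu]_(s in `[0%R, (2 * pi)%R]) (Kpot b0 b1 x (polar (t, s)))%:E =
  (2 * pi * Kmean b0 b1 x.1.1 (cosh t))%:E)%E.
Proof.
move=> Hx t0 ctx; have c1 := H2_fst_ge1 Hx.
have c1' := cosh_ge1 t; have p0 := pi_gt0 R; have [xE _] := Hx.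
pose p := sinh t * x.1.2; pose r := sinh t * x.2.
pose L s := p * cos s + r * sin s.
set c := x.1.1 in c1 ctx xE *; set c' := cosh t in c1' ctx *.
have prE : p ^+ 2 + r ^+ 2 = (c ^+ 2 - 1) * (c' ^+ 2 - 1).
  have := cosh2_sinh2 t; rewrite -/c' /p /r => h.
  rewrite [(sinh t * x.1.2) ^+ 2]exprMn [(sinh t * x.2) ^+ 2]exprMn -mulrDr.
  by rewrite mulrC; congr (_ * _); lra.
have uE s : lform x (polar (t, s)) = c * c' - L s.
  by rewrite lform_polar/= -/c -/c' /L /p /r; ring.
have lnE : \int[mu]_(s in `[0, 2 * pi]) ln (c * c' - 1 - L s) =
             2 * pi * ln ((Num.max c c' - 1) * (Num.min c c' + 1) / 2) /\
           \int[mu]_(s in `[0, 2 * pi]) ln (c * c' + 1 - L s) =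
             2 * pi * ln ((c + 1) * (c' + 1) / 2).
  have [cc'|cc'|cc'] := ltgtP c c'.
  - have prE' : p ^+ 2 + r ^+ 2 = (c' ^+ 2 - 1) * (c ^+ 2 - 1) by rewrite mulrC.
    have [-> ->] := @Rintegral_ln_circle2 c' c p r c1 cc' prE'.
    by rewrite (mulrC (c + 1)).
  - have [] := @Rintegral_ln_circle2 c c' p r c1' cc' prE.
    by rewrite (mulrC c').
  - by rewrite cc' eqxx in ctx.
case: lnE => I1 I2.
(* strict Cauchy-Schwarz: the point is not on the circle *)
have u1 s : 0 < c * c' - 1 - L s.
  have h : 0 < (c - c') ^+ 2 by rewrite exprn_even_gt0//= subr_eq0 eq_sym.
  have : L s ^+ 2 < (c * c' - 1) ^+ 2.
    apply: le_lt_trans (cos_sin_le p r s) _; rewrite prE; nra.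
  rewrite subr_gt0 => hL; apply: le_lt_trans (ler_norm _) _.
  rewrite -(ltr_pXn2r (_ : 0 < 2)%N) ?nnegrE//; last by nra.
  by rewrite real_normK ?num_real.
have u2 s : 0 < c * c' + 1 - L s by have := u1 s; lra.
have cL : continuous L by exact: continuous_cos_sin.
have cu1 : continuous (fun s => ln (c * c' - 1 - L s)).
  apply: continuous_ln_comp => // s; apply: cvgB; first exact: cvg_cst.
  exact: cL.
have cu2 : continuous (fun s => ln (c * c' + 1 - L s)).
  apply: continuous_ln_comp => // s; apply: cvgB; first exact: cvg_cst.
  exact: cL.
pose k := (4 * pi)^-1 : R.
pose C := - b0 * ln 2 + b1 * ((c * c' - 1) / 2).
have KE s : Kpot b0 b1 x (polar (t, s)) =
    - k * ln (c * c' - 1 - L s) + (k + b0) * ln (c * c' + 1 - L s) +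
    (C + (- b1 / 2 * p * cos s + - b1 / 2 * r * sin s)).
  rewrite Kpot_lform//; last exact: polar_H2.
  have := u1 s; have := u2 s; rewrite /Kform /gform /lmean uE -/k => h2 h1.
  have -> : c * c' - L s - 1 = c * c' - 1 - L s by ring.
  have -> : c * c' - L s + 1 = c * c' + 1 - L s by ring.
  have -> : 1 + (c * c' - L s) = c * c' + 1 - L s by ring.
  by rewrite !ln_div ?posrE// /C /L; lra.
have i1 : mu.-integrable `[0, 2 * pi]
    (EFin \o (fun s => - k * ln (c * c' - 1 - L s))).
  apply: continuous_integrable => s; apply: cvgM; first exact: cvg_cst.
  exact: cu1.
have i2 : mu.-integrable `[0, 2 * pi]
    (EFin \o (fun s => (k + b0) * ln (c * c' + 1 - L s))).
  apply: continuous_integrable => s; apply: cvgM; first exact: cvg_cst.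
  exact: cu2.
have i3 : mu.-integrable `[0, 2 * pi] (EFin \o
    (fun s : R => - b1 / 2 * p * cos s + - b1 / 2 * r * sin s)).
  by apply: continuous_integrable; exact: continuous_cos_sin.
have i4 : mu.-integrable `[0, 2 * pi] (EFin \o (fun s : R => C)).
  by apply: continuous_integrable; exact: cst_continuous.
under eq_integral do rewrite KE.
rewrite continuous_integralE; last first.
  move=> s; apply: cvgD; apply: cvgD.
  - by apply: cvgM; [exact: cvg_cst|exact: cu1].
  - by apply: cvgM; [exact: cvg_cst|exact: cu2].
  - exact: cvg_cst.
  - exact: continuous_cos_sin.
congr EFin; rewrite RintegralD//; last 2 first.
- exact: (integrableD _ i1 i2).
- exact: (integrableD _ i4 i3).
rewrite RintegralD// RintegralD//.
rewrite !RintegralZl//; try exact: continuous_integrable.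
rewrite Rintegral_cos_sin addr0 I1 I2 Rintegral_cst//= lebesgue_measure_itv/=.
rewrite lte_fin ifT ?mulr_gt0//= subr0 /C /Kmean /gform /lmean -/k.
have M1 : 1 < Num.max c c'.
  rewrite lt_max; move: ctx c1 c1'; rewrite neq_lt => /orP[]; lra.
have m1 : 1 <= Num.min c c' by rewrite le_min c1 c1'.
have cc' : (c + 1) * (c' + 1) = (Num.max c c' + 1) * (Num.min c c' + 1).
  by case: (leP c c') => _; rewrite 1?mulrC.
rewrite (_ : (1 + c) / 2 = (c + 1) / 2); last by rewrite addrC.
rewrite (_ : (1 + c') / 2 = (c' + 1) / 2); last by rewrite addrC.
have c0 : 0 < c + 1 by lra.
have c0' : 0 < c' + 1 by lra.
have M0 : 0 < Num.max c c' - 1 by lra.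
have M0' : 0 < Num.max c c' + 1 by lra.
have m0 : 0 < Num.min c c' + 1 by lra.
have lE := congr1 (@ln R) cc'; rewrite !lnM ?posrE// in lE.
rewrite !ln_div ?posrE ?mulr_gt0// !lnM ?posrE//.
have -> : ln (Num.min c c' + 1) =
    ln (c + 1) + ln (c' + 1) - ln (Num.max c c' + 1).
  lra.
ring.
Qed.

End kernel.
(** * Potentials of radial densities *)

Section radial_potential.
Context {R : realType}.
Notation mu := (@lebesgue_measure R).
Implicit Types (b c r s t u : R) (x y : R * R * R).

Variables (rho : R * R * R -> R) (f : R -> R).
Hypothesis rhoE : forall x, H2 x -> rho x = f (hdist vertex x).
Hypothesis mrho : measurable_fun H2 rho.
Hypothesis rho0 : forall x, H2 x -> 0 <= rho x.

Lemma rho_polar t s : 0 <= t -> rho (polar (t, s)) = f t.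
Proof.
by move=> t0; rewrite rhoE ?hdist_vertex_polar//; exact: polar_H2.
Qed.

Lemma measurable_radial : measurable_fun (`[0, +oo[%classic : set R) f.
Proof.
have mF' : measurable_fun setT (rho \_ H2).
  by apply/(measurable_restrictT _ measurable_H2).
apply: (eq_measurable_fun ((rho \_ H2) \o polar \o (fun t => (t, 0)))).
  move=> t; rewrite inE/= in_itv/= andbT => t0.
  by rewrite patchE mem_set ?rho_polar//; exact: polar_H2.
apply: measurable_funTS; apply: measurableT_comp; last exact: measurable_pair2.
exact: measurableT_comp mF' (@measurable_polar R).
Qed.

Lemma radial_ge0 t : 0 <= t -> 0 <= f t.
Proof. by move=> t0; rewrite -(rho_polar 0 t0) rho0//; exact: polar_H2. Qed.

(** Density with respect to [t] of the mass in the ball of radius [t]. *)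
Definition wdens t : R := 2 * pi * sinh t * f t.

Lemma measurable_wdens : measurable_fun (`[0, +oo[%classic : set R) wdens.
Proof.
apply: measurable_funM; last exact: measurable_radial.
apply: measurable_funTS; apply: measurable_funM => //; exact: measurable_sinh.
Qed.

Lemma measurable_wdens_Kmean b0 b1 c : 1 <= c ->
  measurable_fun (`[0, +oo[%classic : set R)
    (fun t => (wdens t * Kmean b0 b1 c (cosh t))%:E).
Proof.
move=> c1; apply/measurable_EFinP/measurable_funM; first exact: measurable_wdens.
exact: measurable_Kmean.
Qed.

Lemma wdens_ge0 t : 0 <= t -> 0 <= wdens t.
Proof.
move=> t0; apply: mulr_ge0; last exact: radial_ge0.
by apply: mulr_ge0; [rewrite mulr_ge0// pi_ge0|exact: sinh_ge0].
Qed.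

Lemma integral_radial :
  (\int[hvol]_(x in H2) (rho x)%:E =
   \int[mu]_(t in `[0%R, +oo[) (wdens t)%:E)%E.
Proof.
rewrite ge0_integral_H2//; last exact/measurable_EFinP.
apply: eq_integral => t; rewrite inE/= in_itv/= andbT => t0.
under eq_integral do rewrite rho_polar//.
rewrite integral_cst//= lebesgue_measure_itv/= lte_fin ifT; last first.
  by rewrite mulr_gt0// pi_gt0.
by rewrite -EFinB -!EFinM subr0 /wdens; congr EFin; ring.
Qed.

Lemma Lambda_radial b0 b1 x : 0 <= b0 -> 0 <= b1 -> H2 x ->
  (Lambda b0 b1 rho x =
   \int[mu]_(t in `[0%R, +oo[) (wdens t * Kmean b0 b1 x.1.1 (cosh t))%:E)%E.
Proof.
move=> b00 b10 Hx; have x1 := H2_fst_ge1 Hx.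
have mK := measurable_Kpot b0 b1 Hx.
rewrite /Lambda ge0_integral_H2//; last 2 first.
- by apply/measurable_EFinP; apply: measurable_funM.
- move=> y Hy; rewrite lee_fin mulr_ge0 ?rho0// Kpot_lform//.
  by rewrite Kform_ge0// lform_ge1.
set D := (`[0, +oo[%classic : set R).
pose t0 := hdist vertex x.
have mRHS : measurable_fun D
    (fun t => (wdens t * Kmean b0 b1 x.1.1 (cosh t))%:E).
  exact: measurable_wdens_Kmean.
have E : {in D `\ t0, (fun t => (sinh t)%:E *
    \int[mu]_(s in `[0%R, (2 * pi)%R])
      (Kpot b0 b1 x (polar (t, s)) * rho (polar (t, s)))%:E)%E
    =1 (fun t => (wdens t * Kmean b0 b1 x.1.1 (cosh t))%:E)}.
  move=> t; rewrite inE => -[]; rewrite /D/= in_itv/= andbT => t_0 /eqP tt0.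
  have -> : (\int[mu]_(s in `[0%R, (2 * pi)%R])
      (Kpot b0 b1 x (polar (t, s)) * rho (polar (t, s)))%:E =
    \int[mu]_(s in `[0%R, (2 * pi)%R])
      ((Kpot b0 b1 x (polar (t, s)))%:E * (f t)%:E))%E.
    by apply: eq_integral => s _; rewrite rho_polar// EFinM.
  rewrite ge0_integralZr//; last 3 first.
  - apply/measurable_EFinP; apply: measurable_funTS.
    have mK' : measurable_fun setT (Kpot b0 b1 x \_ H2).
      by apply/(measurable_restrictT _ measurable_H2).
    apply: (eq_measurable_fun ((Kpot b0 b1 x \_ H2) \o polar \o pair t)).
      by move=> s _ /=; rewrite patchE mem_set//; exact: polar_H2.
    apply: measurableT_comp; last exact: measurable_pair1.
    exact: measurableT_comp mK' (@measurable_polar R).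
  - move=> s _; rewrite lee_fin Kpot_lform//; last exact: polar_H2.
    by rewrite Kform_ge0// lform_ge1//; exact: polar_H2.
  - by rewrite lee_fin radial_ge0.
  rewrite integral_Kpot_polar//; last first.
    apply: contra tt0 => /eqP h; apply/eqP; rewrite /t0 hdist_vertex -h.
    by rewrite coshK.
  by rewrite -!EFinM /wdens; congr EFin; ring.
have mD0 : measurable D by exact: measurable_itv.
have mD : measurable (D `\ t0) by exact: measurableD.
rewrite -(@integral_setD1 R _ t0 D)//; last first.
  apply: eq_measurable_fun; first by move=> t tD; exact/esym/E.
  by apply: measurable_funS mRHS => //; exact: subDsetl.
rewrite -[RHS](@integral_setD1 R _ t0 D)//; last first.
  by apply: measurable_funS mRHS => //; exact: subDsetl.
by apply: eq_integral => t tD; exact: E.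
Qed.

End radial_potential.
(** * Potential of a radial mass distribution *)

Section radial_mass.
Context {R : realType}.
Notation mu := (@lebesgue_measure R).
Implicit Types (a b c s t u : R).

(** The field at distance [t] of a unit mass at the centre. *)
Definition gfield t : R := (2 * pi * sinh t)^-1.

Lemma gfield_gt0 t : 0 < t -> 0 < gfield t.
Proof. by move=> t0; rewrite invr_gt0 mulr_gt0 ?sinh_gt0// mulr_gt0// pi_gt0. Qed.

Lemma is_derive_gform_cosh t : 0 < t ->
  is_derive t (1 : R) (fun s => gform (cosh s)) (- gfield t).
Proof.
move=> t0; have c1 := cosh_gt1 t0; have s0 := sinh_gt0 t0.
pose q s : R := cosh s + 1; pose p s : R := cosh s - 1.
have q0 : q t != 0 by rewrite gt_eqF// /q; lra.
have dc := is_derive_cosh t.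
have dq : is_derive t (1 : R) q (sinh t).
  by apply: is_derive_eq; rewrite addr0.
have dp : is_derive t (1 : R) p (sinh t).
  by apply: is_derive_eq; rewrite subr0.
have dV : is_derive t (1 : R) (fun s => (q s)^-1) (- (q t) ^- 2 * sinh t).
  have [dq1 dq2] := dq; apply: DeriveDef; first exact: derivableV.
  by rewrite deriveV// dq2.
pose h s := p s * (q s)^-1.
have dh : is_derive t (1 : R) h
    (p t * (- (q t) ^- 2 * sinh t) + (q t)^-1 * sinh t).
  by apply: is_derive_eq.
have h0 : 0 < h t by rewrite divr_gt0// /p /q; lra.
have dl := is_derive1_ln h0.
have dlh := @is_derive1_comp _ (@ln R) h t _ _ dl dh.
have dk (k : R) : is_derive t (1 : R) (fun s => k * (@ln R \o h) s)
   (k * ((h t)^-1 * (p t * (- (q t) ^- 2 * sinh t) + (q t)^-1 * sinh t))).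
  by apply: is_derive_eq; rewrite /GRing.scale/=; ring.
have := dk (- (4 * pi)^-1).
suff -> : - (4 * pi)^-1 * ((h t)^-1 *
     (p t * (- (q t) ^- 2 * sinh t) + (q t)^-1 * sinh t)) = - gfield t by [].
rewrite /gfield /h /p; rewrite /q in q0 *.
have := cosh2_sinh2 t; have := pi_gt0 R.
move: (cosh t) (sinh t) (@pi R) c1 s0 q0 => c s w c1 s0 q0 w0 cs.
have E : s ^+ 2 = (c - 1) * (c + 1) by lra.
have c10 : c - 1 != 0 by rewrite gt_eqF//; lra.
have sn0 : s != 0 by rewrite gt_eqF.
have wn0 : w != 0 by rewrite gt_eqF.
have -> : - (4 * w)^-1 * (((c - 1) / (c + 1))^-1 *
   ((c - 1) * (- (c + 1) ^- 2 * s) + (c + 1)^-1 * s)) =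
   - (2 * w)^-1 * (s / ((c - 1) * (c + 1))).
  by field; rewrite wn0 q0 c10.
by rewrite -E; field; rewrite wn0 sn0.
Qed.

Lemma continuous_gfield t : 0 < t -> {for t, continuous gfield}.
Proof.
move=> t0; apply: cvgV.
  by rewrite gt_eqF// mulr_gt0 ?sinh_gt0// mulr_gt0// pi_gt0.
by apply: cvgM; [exact: cvg_cst|exact: continuous_sinh].
Qed.

Lemma Rintegral_gfield a b : 0 < a -> a <= b ->
  \int[mu]_(s in `[a, b]) gfield s = gform (cosh a) - gform (cosh b).
Proof.
move=> a0 ab.
have dF x : a <= x <= b ->
    is_derive x (1 : R) (fun s => - gform (cosh s)) (gfield x).
  move=> /andP[ax _]; have := is_derive_gform_cosh (lt_le_trans a0 ax).
  by move=> d; rewrite -[gfield x]opprK; apply: is_deriveN.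
rewrite (Rintegral_FTC ab dF) ?opprK 1?addrC// => x /andP[ax _].
exact: continuous_gfield (lt_le_trans a0 ax).
Qed.

Lemma integrable_gfield a b : 0 < a -> mu.-integrable `[a, b] (EFin \o gfield).
Proof.
move=> a0; apply: continuous_compact_integrable; first exact: segment_compact.
apply: continuous_in_subspaceT => x; rewrite inE/= in_itv/= => /andP[ax _].
exact: continuous_gfield (lt_le_trans a0 ax).
Qed.

Lemma integrable_measurable (D : set R) (f : R -> R) :
  mu.-integrable D (EFin \o f) -> measurable_fun D f.
Proof. by move=> /integrableP[/measurable_EFinP]. Qed.

Lemma integrable_mul_bounded (D : set R) (w h : R -> R) (C : R) :
  measurable D ->
  mu.-integrable D (EFin \o w) -> measurable_fun D h ->
  (forall x, D x -> `|h x| <= C) ->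
  mu.-integrable D (EFin \o (fun x => w x * h x)).
Proof.
move=> mD iw mh hC.
have iC : mu.-integrable D (fun x => (C%:E * (EFin \o w) x)%E).
  exact: integrableZl.
apply: le_integrable iC => //.
  apply/measurable_EFinP; apply: measurable_funM => //.
  exact: integrable_measurable.
move=> x Dx /=; rewrite !normrM mulrC lee_fin ler_wpM2r//.
by rewrite (le_trans (hC x Dx))// ler_norm.
Qed.

Variables (r : R) (w : R -> R).
Hypotheses (r0 : 0 < r) (iw : mu.-integrable `[0, r] (EFin \o w)).
Hypothesis w0 : forall t, 0 <= t <= r -> 0 <= w t.

(** Mass in the ball of radius [s]. *)
Definition mass s : R := \int[mu]_(t in `[0, s]) w t.

Let iwS s : s <= r -> mu.-integrable `[0, s] (EFin \o w).
Proof. by move=> sr; apply: integrableS iw => //; exact: subset_itvl. Qed.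

Let massE s : s <= r -> (\int[mu]_(t in `[0%R, s]) (w t)%:E = (mass s)%:E)%E.
Proof.
move=> sr; rewrite /mass /Rintegral fineK//.
exact: integrable_fin_num (iwS sr).
Qed.

Lemma mass_within_continuous : {within `[0, r], continuous mass}.
Proof. by apply: parameterized_integral_continuous; [exact: ltW|exact: iw]. Qed.

Lemma integrable_gfield_mass a b : 0 < a -> b <= r ->
  mu.-integrable `[a, b] (EFin \o (fun s => gfield s * mass s)).
Proof.
move=> a0 br; apply: continuous_compact_integrable; first exact: segment_compact.
have cm : {within `[a, b], continuous mass}.
  apply: continuous_subspaceW mass_within_continuous.
  by move=> x /=; rewrite !in_itv/= => /andP[ax xb]; apply/andP; split; lra.
have cg : {within `[a, b], continuous gfield}.
  apply: continuous_in_subspaceT => x; rewrite inE/= in_itv/= => /andP[ax _].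
  exact: continuous_gfield (lt_le_trans a0 ax).
by move=> x; apply: cvgM; [exact: cg|exact: cm].
Qed.

Let triangle := [set p : R * R | p.1 <= p.2].

Let triangleE t s : ((t, s) \in triangle) = (t <= s).
Proof. by apply/idP/idP => [/set_mem|?]; [|apply/mem_set]. Qed.

Let measurable_triangle : measurable triangle.
Proof.
have := @measurable_fun_ler _ _ R setT fst snd
  (@measurable_fst _ _ _ _) (@measurable_snd _ _ _ _).
move=> /(_ measurableT [set true] I); rewrite setTI.
by congr measurable; apply/seteqP; split => p /=.
Qed.

(** The contribution to the potential of the mass at [t] and the field at
    [s]. *)
Let kernel a (p : R * R) : R :=
  (w \_ `[0, r]) p.1 * (gfield \_ `[a, r]) p.2 * \1_triangle p.

Let kernelE a t s : kernel a (t, s) =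
  if [&& 0 <= t <= r, a <= s <= r & t <= s] then w t * gfield s else 0.
Proof.
rewrite /kernel /= !patchE indicE triangleE !mem_setE !in_itv/=.
case: (0 <= t <= r); last by rewrite !mul0r.
case: (a <= s <= r); last by rewrite mulr0 mul0r.
by case: (t <= s); rewrite ?mulr1 ?mulr0.
Qed.

Let kernel_ge0 a p : 0 < a -> 0 <= kernel a p.
Proof.
move=> a0; case: p => t s; rewrite kernelE.
case: ifP => // /and3P[t0 /andP[as_ _] _].
by rewrite mulr_ge0 ?w0// ltW// gfield_gt0// (lt_le_trans a0).
Qed.

Let measurable_kernel a : 0 < a -> measurable_fun setT (kernel a).
Proof.
move=> a0.
have mW : measurable_fun setT (w \_ `[0, r]).
  apply/(measurable_restrictT _ (measurable_itv _)).
  exact: integrable_measurable iw.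
have mK : measurable_fun setT (gfield \_ `[a, r]).
  apply/(measurable_restrictT _ (measurable_itv _)).
  exact: integrable_measurable (integrable_gfield r a0).
apply: measurable_funM; last exact: measurable_indic.
apply: measurable_funM.
  exact: measurableT_comp mW (@measurable_fst _ _ _ _).
exact: measurableT_comp mK (@measurable_snd _ _ _ _).
Qed.

Let integral_kernel_snd a t : 0 < a <= r -> 0 <= t <= r ->
  (\int[mu]_s (kernel a (t, s))%:E =
  (w t * (gform (Num.max (cosh a) (cosh t)) - gform (cosh r)))%:E)%E.
Proof.
move=> /andP[a0 ar] /andP[t0 tr].
have art : Num.max a t <= r by rewrite ge_max ar tr.
have at0 : 0 < Num.max a t by rewrite lt_max a0.
have ig := integrable_gfield r at0.
rewrite -cosh_max ?(ltW a0)// -(Rintegral_gfield at0 art) EFinM.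
rewrite [X in (_ * X)%E]fineK; last exact: integrable_fin_num ig.
rewrite -ge0_integralZl//; last 3 first.
- by apply/measurable_EFinP; exact: integrable_measurable ig.
- move=> s /=; rewrite in_itv/= => /andP[h _].
  by rewrite lee_fin ltW// gfield_gt0// (lt_le_trans at0).
- by rewrite lee_fin w0// t0.
rewrite [RHS]integral_mkcond; apply: eq_integral => s _.
rewrite kernelE patchE mem_setE in_itv/= ge_max t0 tr/=.
by case: (a <= s); case: (t <= s); case: (s <= r).
Qed.

Let integral_kernel_fst a s : 0 < a ->
  (\int[mu]_t (kernel a (t, s))%:E =
   (((fun s => (gfield s * mass s)%:E) \_ `[a, r]) s))%E.
Proof.
move=> a0; rewrite patchE mem_setE in_itv/=.
case: ifPn => [/andP[as_ sr]|asr]; last first.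
  by rewrite integral0_eq// => t _; rewrite kernelE (negbTE asr) andbF.
rewrite EFinM -massE// -ge0_integralZl//; last 3 first.
- by apply/measurable_EFinP; exact: integrable_measurable (iwS sr).
- move=> t /=; rewrite in_itv/= => /andP[t0 ts].
  by rewrite lee_fin w0// t0 (le_trans ts).
- by rewrite lee_fin ltW// gfield_gt0// (lt_le_trans a0).
rewrite [RHS]integral_mkcond; apply: eq_integral => t _.
rewrite kernelE patchE mem_setE in_itv/= as_ sr/=.
have [ts|ts] := leP t s; last by rewrite !andbF.
rewrite (le_trans ts sr) !andbT.
by case: (0 <= t) => //; rewrite -EFinM mulrC.
Qed.

(** The Newtonian potential of the mass distribution is obtained by integrating
    the field [gfield s * mass s]: exchange the integrals in [t] and [s]. *)
Lemma integral_gform_max a : 0 < a <= r ->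
  (\int[mu]_(t in `[0%R, r])
     (w t * (gform (Num.max (cosh a) (cosh t)) - gform (cosh r)))%:E =
   (\int[mu]_(s in `[a, r]) (gfield s * mass s))%:E)%E.
Proof.
move=> ar; have [a0 _] := andP ar.
transitivity (\int[mu]_t \int[mu]_s (kernel a (t, s))%:E)%E.
  rewrite integral_mkcond; apply: eq_integral => t _.
  rewrite patchE mem_setE in_itv/=; case: ifPn => [tr|tr].
    by rewrite integral_kernel_snd.
  by rewrite integral0_eq// => s _; rewrite kernelE (negbTE tr).
have mK : measurable_fun setT (EFin \o kernel a).
  by apply/measurable_EFinP; exact: measurable_kernel.
have K0 p : (0 <= (EFin \o kernel a) p)%E by rewrite lee_fin kernel_ge0.
have FT := fubini_tonelli (m1 := mu) (m2 := mu) (EFin \o kernel a) mK K0.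
rewrite [LHS]FT [RHS]fineK; last first.
  exact: integrable_fin_num (integrable_gfield_mass a0 (lexx r)).
rewrite [RHS]integral_mkcond; apply: eq_integral => s _.
exact: integral_kernel_fst.
Qed.

End radial_mass.
Section potential_formula.
Context {R : realType}.
Notation mu := (@lebesgue_measure R).
Implicit Types (a b c s t u : R).

Lemma gform_cosh_le a b : 0 < a -> a <= b -> gform (cosh b) <= gform (cosh a).
Proof.
move=> a0 ab; rewrite -subr_ge0 -Rintegral_gfield//.
apply: Rintegral_ge0 => s; rewrite /= in_itv/= => /andP[h _].
exact/ltW/gfield_gt0/(lt_le_trans a0).
Qed.

Variables (r : R) (w : R -> R).
Hypotheses (r0 : 0 < r) (iw : mu.-integrable `[0, r] (EFin \o w)).
Hypothesis w0 : forall t, 0 <= t <= r -> 0 <= w t.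

(** The integral of [cosh] against the mass distribution. *)
Definition moment : R := \int[mu]_(t in `[0, r]) (w t * cosh t).

(** The potential at distance [a] of the centre, for [0 < a <= r]. *)
Definition radial_pot b0 b1 a : R :=
  gform (cosh r) * mass w r + \int[mu]_(s in `[a, r]) (gfield s * mass w s) +
  b0 * (lmean (cosh a) * mass w r +
        \int[mu]_(t in `[0, r]) (w t * lmean (cosh t))) +
  b1 * ((cosh a * moment - mass w r) / 2).

Let mcosh : measurable_fun (`[0, r]%classic : set R) (@cosh R).
Proof. by apply: measurable_funTS; exact: measurable_cosh. Qed.

Let cosh_ler t : 0 <= t <= r -> cosh t <= cosh r.
Proof. by move=> /andP[t0 tr]; rewrite ler_cosh ?nnegrE// ltW. Qed.

Let icosh : mu.-integrable `[0, r] (EFin \o (fun t => w t * cosh t)).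
Proof.
apply: (@integrable_mul_bounded _ _ _ _ (cosh r)) => // t /=.
rewrite in_itv/= => tr; rewrite ger0_norm ?cosh_ler//.
exact/ltW/cosh_gt0.
Qed.

Let ilmean : mu.-integrable `[0, r] (EFin \o (fun t => w t * lmean (cosh t))).
Proof.
apply: (@integrable_mul_bounded _ _ _ _ (lmean (cosh r))) => //.
  exact: measurable_lmean.
move=> t /=; rewrite in_itv/= => tr.
rewrite ger0_norm ?lmean_ge0 ?cosh_ge1// /lmean ler_ln ?posrE.
- by have := cosh_ler tr; lra.
- by have := cosh_gt0 t; lra.
- by have := cosh_gt0 r; lra.
Qed.

Lemma integral_Kmean b0 b1 a : 0 < a <= r ->
  (\int[mu]_(t in `[0%R, r]) (w t * Kmean b0 b1 (cosh a) (cosh t))%:E =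
   (radial_pot b0 b1 a)%:E)%E.
Proof.
move=> /andP[a0 ar].
pose g t := gform (Num.max (cosh a) (cosh t)) - gform (cosh r).
have ig : mu.-integrable `[0, r] (EFin \o (fun t => w t * g t)).
  apply: (@integrable_mul_bounded _ _ _ _ (gform (cosh a))) => //.
    apply: measurable_funB => //.
    apply: (measurable_gform (h := fun t => Num.max (cosh a) (cosh t))).
      by apply: measurable_maxr => //; exact: measurable_cst.
    by move=> t _; rewrite le_max cosh_ge1.
  move=> t /=; rewrite in_itv/= => /andP[t_0 tr].
  rewrite /g -cosh_max// ?(ltW a0)//.
  have m0 : 0 < Num.max a t by rewrite lt_max a0.
  rewrite ger0_norm.
    rewrite lerBlDr -[leLHS]addr0 lerD ?gform_ge0 ?cosh_ge1//.
    by apply: gform_cosh_le => //; rewrite le_max lexx.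
  by rewrite subr_ge0; apply: gform_cosh_le => //; rewrite ge_max ar.
have Ig : \int[mu]_(t in `[0, r]) (w t * g t) =
    \int[mu]_(s in `[a, r]) (gfield s * mass w s).
  by rewrite /Rintegral integral_gform_max ?a0.
pose C := gform (cosh r) + b0 * lmean (cosh a) - b1 / 2.
pose D := b1 / 2 * cosh a.
have KE t : w t * Kmean b0 b1 (cosh a) (cosh t) =
    w t * g t + (C * w t + (b0 * (w t * lmean (cosh t)) + D * (w t * cosh t))).
  by rewrite /Kmean /g /C /D; field.
have iZ (k : R) (h : R -> R) : mu.-integrable `[0, r] (EFin \o h) ->
    mu.-integrable `[0, r] (EFin \o (fun t => k * h t)).
  by move=> ih; apply: (@integrableZl _ _ R mu _ _ k (EFin \o h)).
have iD (h k : R -> R) : mu.-integrable `[0, r] (EFin \o h) ->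
    mu.-integrable `[0, r] (EFin \o k) ->
    mu.-integrable `[0, r] (EFin \o (fun t => h t + k t)).
  by move=> ih ik; apply: (integrableD _ ih ik).
have i1 := iZ C _ iw; have i2 := iZ b0 _ ilmean; have i3 := iZ D _ icosh.
have i23 := iD _ _ i2 i3; have i123 := iD _ _ i1 i23; have i := iD _ _ ig i123.
under eq_integral do rewrite KE.
rewrite -[LHS]fineK; last exact: integrable_fin_num i.
congr EFin; rewrite -/(Rintegral _ _ _) RintegralD// RintegralD// RintegralD//.
rewrite !RintegralZl// Ig -/moment -/(mass w r) /radial_pot /C /D.
by field.
Qed.

(** Two-point form, in which the constants of the potential cancel. *)
Lemma radial_potB b0 b1 a b : 0 < a -> a <= b -> b <= r ->
  radial_pot b0 b1 a - radial_pot b0 b1 b =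
  \int[mu]_(s in `[a, b]) (gfield s * mass w s) -
  (b0 * mass w r * (lmean (cosh b) - lmean (cosh a)) +
   b1 * moment / 2 * (cosh b - cosh a)).
Proof.
move=> a0 ab br; rewrite /radial_pot.
rewrite (@Rintegral_split _ (fun s => gfield s * mass w s) a b r) //; last first.
  exact: (integrable_gfield_mass r0 iw a0 (lexx r)).
by field.
Qed.

End potential_formula.
(** * The volume measure near a point *)

Section volume_lower_bound.
Context {R : realType}.
Notation mu := (@lebesgue_measure R).
Implicit Types (t s : R) (x y : R * R * R).

(** A lower bound by the volume of a sector with radii in [E] and angles in
    [[s1, s2[]. *)
Lemma hvol_ge_sector (t1 s1 s2 : R) (E : set R) (S : set (R * R * R)) :
  measurable E -> measurable S -> 0 < t1 -> 0 <= s1 -> s1 <= s2 ->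
  s2 <= 2 * pi ->
  (forall t, E t -> t1 <= t) ->
  (forall t s, E t -> s1 <= s < s2 -> S (polar (t, s))) ->
  ((sinh t1 * (s2 - s1))%:E * mu E <= hvol S)%E.
Proof.
move=> mE mS t1_0 s1_0 s12 s2pi Et1 ES.
pose B := E `*` `[s1, s2[%classic : set (R * R).
have mB : measurable B by exact: measurableX.
have BS : B `<=` polar_domain `&` polar @^-1` S.
  move=> [t s] [/= Et]; rewrite in_itv/= => /andP[s1s ss2]; split; last first.
    by apply: ES => //; rewrite s1s.
  split; rewrite /= in_itv/=.
    by rewrite andbT (le_trans (ltW t1_0))// Et1.
  by rewrite (le_trans s1_0)//= (lt_le_trans ss2).
have msh : measurable_fun setT (fun p : R * R => (sinh p.1)%:E).
  by apply/measurable_EFinP; exact: measurableT_comp measurable_sinh _.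
have mPS : measurable (polar_domain `&` polar @^-1` S).
  apply: measurableI; first exact: measurable_polar_domain.
  by rewrite -[X in measurable X]setTI; exact: measurable_polar.
rewrite hvolE//.
apply: (@le_trans _ _ (\int[mu \x mu]_(p in B) (sinh p.1)%:E)%E); last first.
  apply: ge0_subset_integral => //; first exact: measurable_funTS.
  move=> [t s] [[/= + _] _]; rewrite in_itv/= andbT lee_fin; exact: sinh_ge0.
have <- : (\int[mu \x mu]_(p in B) (sinh t1)%:E =
    (sinh t1 * (s2 - s1))%:E * mu E)%E.
  have -> : ((sinh t1 * (s2 - s1))%:E * mu E =
      (sinh t1)%:E * (mu E * (s2 - s1)%:E))%E.
    by rewrite (EFinM (sinh t1)) -muleA [((s2 - s1)%:E * _)%E]muleC.
  have BE : ((mu \x mu) B = mu E * mu `[s1, s2[%classic)%E.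
    exact: product_measure1E.
  rewrite integral_cst// [X in (_ * X)%E]BE; congr (_ * (_ * _))%E.
  rewrite [mu `[s1, s2[%classic]lebesgue_measure_itv/= lte_fin.
  case: ltP => // s21.
  by rewrite (_ : s1 = s2) ?subrr//; apply/eqP; rewrite eq_le s12.
apply: ge0_le_integral => //.
- by move=> p _; rewrite lee_fin sinh_ge0// ltW.
- exact: measurable_funTS.
- by move=> [t s] [/= Et _]; rewrite lee_fin ler_sinh// Et1.
Qed.

Lemma hdist_polar_near x t s e : H2 x -> x = polar (t, s) -> 0 < e ->
  exists2 d : R, 0 < d & forall t' s', `|t' - t| < d -> `|s' - s| < d ->
    hdist x (polar (t', s')) < e.
Proof.
move=> Hx xE e0.
have lxx : lform x x = 1 by have [h _] := Hx; rewrite /lform; lra.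
pose F (p : R * R) := lform x (polar p).
have cF : continuous F.
  have -> : F = fun q => x.1.1 * cosh q.1 -
      sinh q.1 * (x.1.2 * cos q.2 + x.2 * sin q.2).
    by apply/funext => q; exact: lform_polar.
  move=> p; have c1 : (fun q : R * R => q.1) @ p --> p.1 by exact: cvg_fst.
  have c2 : (fun q : R * R => q.2) @ p --> p.2 by exact: cvg_snd.
  apply: cvgB.
    apply: cvgM; first exact: cvg_cst.
    by apply: continuous_cvg; [exact: continuous_cosh|exact: c1].
  apply: cvgM.
    by apply: continuous_cvg; [exact: continuous_sinh|exact: c1].
  apply: cvgD; (apply: cvgM; first exact: cvg_cst).
    by apply: continuous_cvg; [exact: continuous_cos|exact: c2].
  by apply: continuous_cvg; [exact: continuous_sin|exact: c2].
have : \forall q \near (t, s), F q < cosh e.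
  have h : F (t, s) < cosh e by rewrite /F -xE lxx cosh_gt1.
  exact: (cF (t, s) [set u | u < cosh e] (lt_nbhsl h)).
move=> /nbhs_ballP[d /= d0 hd]; exists d => // t' s' tt' ss'.
rewrite hdist_lt ?ltW//; last exact: polar_H2.
by apply: hd; split; rewrite /ball/= distrC.
Qed.

Lemma measurable_supp_ball (rho : R * R * R -> R) x e : H2 x -> 0 < e ->
  measurable_fun H2 rho ->
  measurable [set y | [/\ H2 y, hdist x y < e & rho y != 0]].
Proof.
move=> Hx e0 mrho.
have -> : [set y | [/\ H2 y, hdist x y < e & rho y != 0]] =
    (H2 `&` lform x @^-1` `]-oo, cosh e[) `&` (H2 `&` rho @^-1` [set~ 0]).
  apply/seteqP; split => y /=; rewrite in_itv/=.
    by move=> [Hy dy /eqP ry]; rewrite -hdist_lt// ltW.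
  by move=> [[Hy ly] [_ ry]]; split => //; [rewrite hdist_lt// ltW|exact/eqP].
apply: measurableI; last first.
  by apply: mrho; [exact: measurable_H2|exact: measurableC].
apply: (measurable_lform); [exact: measurable_H2|exact: measurable_itv].
Qed.

Lemma ae_lebesgueS (P Q : R -> Prop) : (forall t, P t -> Q t) ->
  {ae mu, forall t, P t} -> {ae mu, forall t, Q t}.
Proof.
by move=> PQ; apply: filterS; first exact: (ae_filter_ringOfSetsType mu).
Qed.

(** A nonnegative function that vanishes almost everywhere beyond [r]. *)
Lemma radial_tail (F : R -> \bar R) (r : R) : 0 <= r ->
  measurable_fun (`[0, +oo[%classic : set R) F ->
  (forall t, 0 <= t -> (0 <= F t)%E) ->
  {ae mu, forall t, r < t -> F t = 0%E} ->
  (\int[mu]_(t in `[0%R, +oo[) F t = \int[mu]_(t in `[0%R, r]) F t)%E.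
Proof.
move=> r0 mF F0 Fr.
have U : (`[0, +oo[%classic : set R) = `[0, r] `|` `]r, +oo[.
  apply/seteqP; split => t /=; rewrite !in_itv/= !andbT.
    by move=> t0; have [tr|rt] := leP t r; [left; rewrite t0|right].
  by case=> [/andP[]//|/ltW]; exact: le_trans.
have m1 : measurable_fun (`]r, +oo[%classic : set R) F.
  by apply: measurable_funS mF => //; rewrite U; exact: subsetUr.
rewrite U ge0_integral_setU//=.
- rewrite [X in (_ + X)%E](_ : _ = 0)%E ?adde0//.
  rewrite (ae_eq_integral (cst 0%E))//.
    by rewrite integral_cst// mul0e.
  move: Fr; apply: ae_lebesgueS => t h /=; rewrite in_itv/= andbT; exact: h.
- by rewrite -U.
- move=> t []; rewrite in_itv/= ?andbT; first by move=> /andP[/F0].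
  by move=> /ltW/(le_trans r0)/F0.
- rewrite disj_set2E; apply/eqP; rewrite -subset0 => t [] /=.
  by rewrite !in_itv/= andbT => /andP[_ tr]; rewrite ltNge tr.
Qed.

Variables (rho : R * R * R -> R) (f : R -> R) (r : R).
Hypothesis rhoE : forall x, H2 x -> rho x = f (hdist vertex x).
Hypothesis mrho : measurable_fun H2 rho.
Hypothesis rho0 : forall x, H2 x -> 0 <= rho x.
Hypothesis r0 : 0 < r.
Hypothesis fr : {ae mu, forall t, r < t -> f t = 0}.

Let wdens0 : {ae mu, forall t, r < t -> wdens f t = 0}.
Proof. by move: fr; apply: ae_lebesgueS => t h rt; rewrite /wdens h// mulr0. Qed.

Lemma integral_radial_ball :
  (\int[hvol]_(x in H2) (rho x)%:E =
   \int[mu]_(t in `[0%R, r]) (wdens f t)%:E)%E.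
Proof.
rewrite (integral_radial rhoE)// (radial_tail (r := r)) ?(ltW r0)//.
- by apply/measurable_EFinP; exact: (measurable_wdens rhoE mrho).
- by move=> t t0; rewrite lee_fin (wdens_ge0 rhoE).
- by move: wdens0; apply: ae_lebesgueS => t h rt; rewrite h.
Qed.

Lemma Lambda_radial_pot b0 b1 x : 0 <= b0 -> 0 <= b1 -> H2 x ->
  mu.-integrable `[0, r] (EFin \o wdens f) ->
  0 < hdist vertex x <= r ->
  Lambda b0 b1 rho x = (radial_pot r (wdens f) b0 b1 (hdist vertex x))%:E.
Proof.
move=> b00 b10 Hx iw /andP[x0 xr].
rewrite (Lambda_radial rhoE)// (radial_tail (r := r)) ?(ltW r0)//.
- rewrite -integral_Kmean//; last by rewrite x0.
    by rewrite cosh_hdist_vertex.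
  by move=> t /andP[t0 _]; exact: (wdens_ge0 rhoE).
- exact: (measurable_wdens_Kmean rhoE mrho b0 b1 (H2_fst_ge1 Hx)).
- move=> t t0; rewrite lee_fin mulr_ge0 ?(wdens_ge0 rhoE)//.
  by rewrite Kmean_ge0 ?cosh_ge1//; exact: H2_fst_ge1.
- by move: wdens0; apply: ae_lebesgueS => t h rt; rewrite h// mul0r.
Qed.

End volume_lower_bound.
(** * Existence of the equilibrium *)

Section existence.
Context {R : realType}.
Notation mu := (@lebesgue_measure R).
Implicit Types (s t : R) (x y : R * R * R).

(** The mass in the ball of radius [s] of the density [b0 + beta cosh]. *)
Definition emass (b0 beta s : R) : R :=
  2 * pi * (b0 * (cosh s - 1) + beta * ((cosh s ^+ 2 - 1) / 2)).

Lemma is_derive_emass b0 beta s :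
  is_derive s (1 : R) (emass b0 beta) (2 * pi * sinh s * (b0 + beta * cosh s)).
Proof.
rewrite /emass; move: (2 * pi) => k; have dc := is_derive_cosh s.
by apply: is_derive_eq; rewrite /GRing.scale/= !exprS expr0; field.
Qed.

Lemma continuous_edens (b0 beta : R) :
  continuous (fun t : R => 2 * pi * sinh t * (b0 + beta * cosh t)).
Proof.
move=> t; apply: cvgM.
  by apply: cvgM; [exact: cvg_cst|exact: continuous_sinh].
apply: cvgD; first exact: cvg_cst.
by apply: cvgM; [exact: cvg_cst|exact: continuous_cosh].
Qed.

Lemma Rintegral_emass b0 beta s : 0 <= s ->
  \int[mu]_(t in `[0, s]) (2 * pi * sinh t * (b0 + beta * cosh t)) =
  emass b0 beta s.
Proof.
move=> s0; rewrite (Rintegral_FTC s0 (fun t _ => is_derive_emass b0 beta t)).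
  rewrite [X in _ - X](_ : _ = 0) ?subr0//.
  by rewrite /emass cosh0 expr1n !subrr mul0r !mulr0 addr0 mulr0.
by move=> t _; exact: continuous_edens.
Qed.

Lemma Rintegral_emoment b0 beta s : 0 <= s ->
  \int[mu]_(t in `[0, s]) (2 * pi * sinh t * (b0 + beta * cosh t) * cosh t) =
  2 * pi * (b0 * ((cosh s ^+ 2 - 1) / 2) + beta * ((cosh s ^+ 3 - 1) / 3)).
Proof.
move=> s0.
pose F t : R := 2 * pi *
  (b0 * ((cosh t ^+ 2 - 1) / 2) + beta * ((cosh t ^+ 3 - 1) / 3)).
have dF t : is_derive t (1 : R) F
    (2 * pi * sinh t * (b0 + beta * cosh t) * cosh t).
  rewrite /F; move: (2 * pi) => k; have dc := is_derive_cosh t.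
  by apply: is_derive_eq; rewrite /GRing.scale/= !exprS expr0; field.
rewrite (Rintegral_FTC s0 (fun t _ => dF t)).
  rewrite [X in _ - X](_ : _ = 0) ?subr0//.
  by rewrite /F cosh0 !expr1n !subrr !mul0r !mulr0 addr0 mulr0.
by move=> t _; apply: cvgM; [exact: continuous_edens|exact: continuous_cosh].
Qed.

(** The field of the density [b0 + beta cosh] balances the confinement. *)
Lemma Rintegral_gfield_emass b0 beta a b : 0 < a -> a <= b ->
  \int[mu]_(s in `[a, b]) (gfield s * emass b0 beta s) =
  b0 * (lmean (cosh b) - lmean (cosh a)) + beta / 2 * (cosh b - cosh a).
Proof.
move=> a0 ab.
pose F s : R := b0 * lmean (cosh s) + beta / 2 * cosh s.
have dF s : is_derive s (1 : R) F (b0 * dlmean s + beta / 2 * sinh s).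
  have dl := is_derive_lmean_cosh s; have dc := is_derive_cosh s.
  by apply: is_derive_eq; rewrite /GRing.scale/=; field.
transitivity (\int[mu]_(s in `[a, b]) (b0 * dlmean s + beta / 2 * sinh s)).
  apply: eq_Rintegral => s; rewrite inE/= in_itv/= => /andP[as_ _].
  have s0 := sinh_gt0 (lt_le_trans a0 as_); have c0 := cosh_gt0 s.
  rewrite /gfield /emass /dlmean; have := cosh2_sinh2 s; have := pi_gt0 R.
  move: (cosh s) (sinh s) (@pi R) s0 c0 => c sh p s0 c0 p0 cs.
  have c1 : 0 < 1 + c by lra.
  have E : c - 1 = sh ^+ 2 / (1 + c).
    by rewrite (_ : sh ^+ 2 = (c - 1) * (1 + c)) ?mulfK ?gt_eqF//; lra.
  rewrite (_ : c ^+ 2 - 1 = sh ^+ 2) ?E; last by lra.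
  by field; rewrite !gt_eqF.
rewrite (Rintegral_FTC ab (fun s _ => dF s)); first by rewrite /F; ring.
move=> s _; apply: cvgD; apply: cvgM; (try exact: cvg_cst).
  exact: continuous_dlmean.
exact: continuous_sinh.
Qed.

Variables (b0 b1 alpha : R).
Hypotheses (b0_ge0 : 0 <= b0) (b1_ge0 : 0 <= b1).
Hypothesis alpha_gt0 : 0 < alpha.

(** The radius of the support and the coefficient of [cosh] in the density. *)
Let r : R := acosh (alpha + 1).
Let beta : R := (1 - 2 * pi * b0 * alpha) / (pi * alpha * (alpha + 2)).

Lemma cosh_radius : cosh r = alpha + 1.
Proof. by apply: acoshK; rewrite lerDr ltW. Qed.

Lemma radius_gt0 : 0 < r.
Proof.
rewrite lt_neqAle eq_sym /r acosh_ge0 ?andbT; last by rewrite lerDr ltW.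
by apply/eqP => h; have := cosh_radius; rewrite /r h cosh0; move: alpha_gt0; lra.
Qed.

Hypothesis beta_ge0 : 0 <= beta.
Hypothesis density_neq0 : b0 + beta != 0.

Lemma rhot_mE t : t <= r -> rhot_m b0 alpha t = b0 + beta * cosh t.
Proof. by move=> tr; rewrite /rhot_m ifT. Qed.

Lemma rhot_m_out t : r < t -> rhot_m b0 alpha t = 0.
Proof. by move=> rt; rewrite /rhot_m leNgt rt. Qed.

Lemma rhot_m_ge0 t : 0 <= rhot_m b0 alpha t.
Proof.
have [tr|tr] := leP t r; last by rewrite rhot_m_out.
by rewrite rhot_mE// addr_ge0// mulr_ge0// ltW// cosh_gt0.
Qed.

Lemma measurable_rhot_m : measurable_fun setT (rhot_m b0 alpha).
Proof.
rewrite (_ : rhot_m b0 alpha =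
    fun t => (b0 + beta * cosh t) * \1_(`]-oo, r]%classic : set R) t); last first.
  apply/funext => t; have [tr|tr] := leP t r.
    by rewrite rhot_mE// indicE mem_set ?mulr1//= in_itv.
  rewrite rhot_m_out// indicE memNset ?mulr0//= in_itv/= => h.
  by move: tr; rewrite ltNge h.
apply: measurable_funM; last exact: measurable_indic.
apply: measurable_funD => //; apply: measurable_funM => //.
exact: measurable_cosh.
Qed.

Lemma measurable_hdist_vertex : measurable_fun H2 (hdist (vertex : R * R * R)).
Proof.
rewrite (_ : hdist vertex = acosh \o (fun x : R * R * R => x.1.1)); last first.
  by apply/funext => x; exact: hdist_vertex.
apply: measurable_funTS; apply: measurableT_comp; last exact: measurableT_comp.
apply: measurableT_comp; first exact: measurable_ln.
apply: measurable_funD => //.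
apply: (measurableT_comp (f := @Num.sqrt R)).
  by apply: continuous_measurable_fun; exact: sqrt_continuous.
by apply: measurable_funB.
Qed.

Let rho x := rhot_m b0 alpha (hdist vertex x).

Lemma measurable_rho : measurable_fun H2 rho.
Proof. exact: measurableT_comp measurable_rhot_m measurable_hdist_vertex. Qed.

Let w t : R := 2 * pi * sinh t * (b0 + beta * cosh t).

Let cw : continuous w. Proof. exact: continuous_edens. Qed.

Let wE t : t <= r -> wdens (rhot_m b0 alpha) t = w t.
Proof. by move=> tr; rewrite /wdens rhot_mE. Qed.

Let iw : mu.-integrable `[0, r] (EFin \o wdens (rhot_m b0 alpha)).
Proof.
have iw : mu.-integrable `[0, r] (EFin \o w) by exact: continuous_integrable.
apply: eq_integrable iw => // t; rewrite inE/= in_itv/= => /andP[_ tr].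
by rewrite wE.
Qed.

Let massE s : 0 <= s <= r -> mass (wdens (rhot_m b0 alpha)) s = emass b0 beta s.
Proof.
move=> /andP[s0 sr]; rewrite /mass -Rintegral_emass//.
apply: eq_Rintegral => t; rewrite inE/= in_itv/= => /andP[_ ts].
by rewrite wE// (le_trans ts).
Qed.

Lemma emass_radius : emass b0 beta r = 1.
Proof.
rewrite /emass cosh_radius /beta; have := pi_gt0 R.
move: (@pi R) => p p0; field.
by rewrite !gt_eqF// addr_gt0.
Qed.

Let momentE : moment r (wdens (rhot_m b0 alpha)) =
  2 * pi * (b0 * (((alpha + 1) ^+ 2 - 1) / 2) +
            beta * (((alpha + 1) ^+ 3 - 1) / 3)).
Proof.
rewrite -cosh_radius -Rintegral_emoment ?ltW ?radius_gt0//.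
apply: eq_Rintegral => t; rewrite inE/= in_itv/= => /andP[_ tr].
by rewrite wE.
Qed.

Lemma rho_prob_density : prob_density rho.
Proof.
split; first exact: measurable_rho.
  by move=> x _; exact: rhot_m_ge0.
have out : {ae mu, forall t, r < t -> rhot_m b0 alpha t = 0}.
  by apply: aeW => t; exact: rhot_m_out.
rewrite (integral_radial_ball (f := rhot_m b0 alpha)
  _ measurable_rho _ radius_gt0 out)//.
  rewrite -[LHS]fineK; last exact: integrable_fin_num iw.
  rewrite -/(Rintegral _ _ _) -/(mass _ _) massE ?emass_radius//.
  by rewrite lexx ltW// radius_gt0.
by move=> x _; exact: rhot_m_ge0.
Qed.

Lemma hsupp_rho : hsupp rho = [set x | H2 x /\ hdist vertex x <= r].
Proof.
have r0 := radius_gt0.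
apply/seteqP; split => x /= [Hx]; last first.
  move=> xr; split=> // e e0.
  have [s /andP[s0 s2] xE] := polar_surj Hx; have x0 := hdist_vertex_ge0 Hx.
  have [d d0 hd] := hdist_polar_near Hx xE e0.
  set t := hdist vertex x in xr xE x0 hd *.
  pose m := Num.min d r; have m0 : 0 < m by rewrite lt_min d0.
  have md : m <= d by rewrite ge_min lexx.
  have mr : m <= r by rewrite ge_min lexx orbT.
  (* a range of positive radii in the ball and close to [t]; it lies beyond [t]
     when [t] is small, as [t] may be [0] *)
  have [t1 [t2 [t10 t12 t2r tt1 tt2]]] : exists t1 t2,
      [/\ 0 < t1, t1 < t2, t2 <= r, t - d < t1 & t2 < t + d].
    have [tm|tm] := leP (m / 2) t.
      by exists (t - m / 4), t; split; lra.
    by exists (t + m / 8), (t + m / 4); split; lra.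
  pose s' := Num.min (s + d) (2 * pi).
  have ss' : s < s' by rewrite lt_min s2 andbT; lra.
  have := @hvol_ge_sector _ t1 s s' `]t1, t2[
    [set y | [/\ H2 y, hdist x y < e & rho y != 0]].
  have mS := measurable_supp_ball Hx e0 measurable_rho.
  move=> /(_ (measurable_itv _) mS t10 s0 (ltW ss')).
  have -> : s' <= 2 * pi by rewrite ge_min lexx orbT.
  move=> /(_ isT) H; apply: lt_le_trans (H _ _).
  - rewrite lebesgue_measure_itv/= lte_fin t12 -EFinB -EFinM lte_fin.
    rewrite pmulr_lgt0 ?subr_gt0// pmulr_lgt0 ?subr_gt0//; exact: sinh_gt0.
  - by move=> u /=; rewrite in_itv/= => /andP[/ltW].
  - move=> u v /=; rewrite in_itv/= => /andP[t1u ut2] /andP[sv vs'].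
    split; first exact: polar_H2.
    + apply: hd; rewrite ltr_distl; first by apply/andP; split; lra.
      move: vs'; rewrite lt_min => /andP[vs' _].
      by apply/andP; split; lra.
    + rewrite /rho hdist_vertex_polar/=; last by lra.
      rewrite rhot_mE; last by lra.
      have := cosh_ge1 u; move: density_neq0; rewrite !neq_lt => h c1.
      have bc : beta <= beta * cosh u by rewrite ler_peMr.
      have b00 := b0_ge0; have be0 := beta_ge0.
      by apply/orP; right; case/orP: h; lra.
move=> supp; split => //; rewrite leNgt; apply/negP => rx.
have e0 : 0 < hdist vertex x - r by rewrite subr_gt0.
have := supp _ e0; rewrite (_ : [set y | _] = set0) ?measure0 ?ltxx//.
apply/seteqP; split => y //= [Hy]; rewrite hdist_lt ?ltW// => ly ry.
have yr : hdist vertex y <= r.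
  by rewrite leNgt; apply: contra ry => /rhot_m_out; rewrite /rho => ->.
have := le_lt_trans (cosh_hdistB_le Hx Hy) ly.
by rewrite ltr_cosh ?nnegrE; lra.
Qed.

(** The polynomial equation says that [beta] is [b1] times the moment of the
    density. *)
Hypothesis alpha_root :
  1 - 2 * pi * (b0 + b1) * alpha - 2 * pi * b1 * alpha ^+ 2
    - (2 * pi * b1) / 3 * alpha ^+ 3
    + (pi ^+ 2 * b0 * b1) / 3 * alpha ^+ 4 = 0.

Lemma b1_moment : b1 * moment r (wdens (rhot_m b0 alpha)) = beta.
Proof.
rewrite momentE /beta; have := alpha_root; have := pi_gt0 R.
move: (@pi R) => p p0 pE.
have a0 := alpha_gt0.
apply/eqP; rewrite -subr_eq0.
set q := 1 - _ - _ - _ + _ in pE.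
rewrite (_ : _ - _ = - (q / (p * alpha * (alpha + 2)))).
  by rewrite pE mul0r oppr0.
by rewrite /q; field; rewrite !gt_eqF// addr_gt0.
Qed.

(** Almost every point is considered only in order to leave out the vertex. *)
Lemma rho_radial_equilibrium : radial_equilibrium b0 b1 rho.
Proof.
have r0 := radius_gt0; split.
- split; first exact: rho_prob_density.
  exists (radial_pot r (wdens (rhot_m b0 alpha)) b0 b1 r).
  have out : {ae mu, forall t, r < t -> rhot_m b0 alpha t = 0}.
    by apply: aeW => t; exact: rhot_m_out.
  have Z : hvol.-negligible [set x : R * R * R | x.1.1 = 1].
    have mZ : measurable [set x : R * R * R | x.1.1 = 1].
      rewrite -[X in measurable X]setTI.
      have m11 : measurable_fun setT (fun x : R * R * R => x.1.1).
        exact: measurableT_comp.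
      exact: (m11 measurableT [set 1] (measurable_set1 1)).
    exists [set x : R * R * R | x.1.1 = 1]; split => //.
    rewrite [LHS]hvolE// integral0_eq// => -[t s] [[/= + _]].
    rewrite in_itv/= andbT => t0 c1; congr EFin.
    by rewrite (_ : t = 0) ?sinh0//; apply: cosh_inj; rewrite ?nnegrE// cosh0.
  apply: negligibleS Z => x /= /not_implyP[]; rewrite hsupp_rho /= => -[Hx xr] nL.
  apply: contrapT => x1; apply: nL.
  have x0 : 0 < hdist vertex x.
    rewrite lt_neqAle eq_sym hdist_vertex_ge0// andbT; apply/eqP => h.
    by apply: x1; rewrite -(cosh_hdist_vertex Hx) h cosh0.
  rewrite (Lambda_radial_pot (f := rhot_m b0 alpha)
    _ measurable_rho _ r0 out)// ?x0//; last first.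
    by move=> y _; exact: rhot_m_ge0.
  congr EFin; apply/eqP; rewrite -subr_eq0.
  have mr : mass (wdens (rhot_m b0 alpha)) r = 1.
    by rewrite massE ?emass_radius// lexx ltW.
  rewrite (radial_potB r0 iw b0 b1 x0 xr (lexx r)) b1_moment mr mulr1.
  rewrite [X in X - _](_ : _ = \int[mu]_(s in `[hdist vertex x, r])
      (gfield s * emass b0 beta s)); last first.
    apply: eq_Rintegral => s; rewrite inE/= in_itv/= => /andP[xs sr].
    by rewrite massE// sr (le_trans (ltW x0)).
  by rewrite Rintegral_gfield_emass// subrr.
- by exists (rhot_m b0 alpha).
- by exists r => //; exact: hsupp_rho.
Qed.

End existence.
(** * Uniqueness of the equilibrium *)

Section null_sets.
Context {R : realType}.
Notation mu := (@lebesgue_measure R).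

(** A set that is negligible near each of its points is negligible: rational
    intervals form a countable basis. *)
Lemma negligible_near (N : set R) :
  (forall t, N t -> exists t1 t2, [/\ t1 < t, t < t2 &
     mu.-negligible (`]t1, t2[ `&` N)]) ->
  mu.-negligible N.
Proof.
move=> locN.
pose J (q : rat * rat) := `]ratr q.1, ratr q.2[%classic `&` N.
pose F n := if pickle_inv n is Some q then
  (if `[< mu.-negligible (J q) >] then J q else set0) else set0.
have negF n : mu.-negligible (F n).
  rewrite /F; case: pickle_inv => [q|]; last exact: negligible_set0.
  by case: asboolP => // _; exact: negligible_set0.
have FE q : mu.-negligible (J q) -> F (pickle q) = J q.
  by rewrite /F pickleK_inv; case: asboolP.
clearbody F; apply: negligibleS (negligible_bigcup negF) => t Nt.
have [t1 [t2 [t1t tt2 N12]]] := locN t Nt.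
have [p] := rat_in_itvoo t1t; have [q] := rat_in_itvoo tt2.
rewrite !in_itv/= => /andP[tq qt2] /andP[t1p pt].
have neg : mu.-negligible (J (p, q)).
  apply: negligibleS N12 => u [/=]; rewrite !in_itv/= => /andP[pu uq] Nu.
  split; last exact: Nu.
  by rewrite /= (lt_trans t1p pu) (lt_trans uq qt2).
exists (pickle (p, q)); first exact: I.
rewrite FE//; split; last exact: Nt.
by rewrite /= in_itv/= pt.
Qed.

(** A property of almost all radii holds almost everywhere in the plane. *)
Lemma ae_radial (P : R -> Prop) : {ae mu, forall t, 0 <= t -> P t} ->
  {ae hvol, forall x : R * R * R, H2 x -> P (hdist vertex x)}.
Proof.
move=> [N [mN N0 subN]].
pose B := H2 `&` hdist (vertex : R * R * R) @^-1` N.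
have mB : measurable B.
  by apply: measurable_hdist_vertex => //; exact: measurable_H2.
exists B; split => //.
- rewrite [LHS]hvolE//; apply: null_set_integral.
  + apply: measurableI; first exact: measurable_polar_domain.
    by rewrite -[X in measurable X]setTI; exact: measurable_polar.
  + by apply/measurable_EFinP/measurable_funTS;
      exact: measurableT_comp measurable_sinh _.
  + have null : ((mu \x mu) (N `*` setT) = mu N * mu setT)%E.
      exact: product_measure1E.
    apply: (subset_measure0 (B := N `*` setT)) => //.
    * apply: measurableI; first exact: measurable_polar_domain.
      by rewrite -[X in measurable X]setTI; exact: measurable_polar.
    * exact: measurableX.
    * move=> [t s] [[/= + _] [_ /=]]; rewrite in_itv/= andbT => t0.
      by rewrite hdist_vertex_polar.
    * by move: null; rewrite N0 mul0e.
- move=> x /= /not_implyP[Hx nP]; split => //; apply: subN => /= h.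
  by apply: nP; apply: h; exact: hdist_vertex_ge0.
Qed.

End null_sets.

Section uniqueness.
Context {R : realType}.
Notation mu := (@lebesgue_measure R).
Implicit Types (s t : R) (x y : R * R * R).

Variables (rho : R * R * R -> R) (f : R -> R) (r : R).
Hypothesis rhoE : forall x, H2 x -> rho x = f (hdist vertex x).
Hypothesis mrho : measurable_fun H2 rho.
Hypothesis rho0 : forall x, H2 x -> 0 <= rho x.
Hypothesis r0 : 0 < r.
Hypothesis suppE : hsupp rho = [set x | H2 x /\ hdist vertex x <= r].

Let N := [set t | r < t /\ f t <> 0].

(** The density vanishes near every circle outside the support. *)
Let negligible_outside_near t : N t -> exists t1 t2, [/\ t1 < t, t < t2 &
     mu.-negligible (`]t1, t2[ `&` N)].
Proof.
move=> [rt _]; have t0 : 0 < t := lt_trans r0 rt.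
pose x : R * R * R := polar (t, 0); have Hx : H2 x by exact: polar_H2.
have : ~ hsupp rho x.
  rewrite suppE /= => -[_]; rewrite hdist_vertex_polar/= ?(ltW t0)//.
  by rewrite leNgt rt.
move=> /not_andP[//|/existsNP[e /not_implyP[e0 /negP]]].
rewrite -leNgt; set S := [set y | _] => S0.
have mS : measurable S by exact: measurable_supp_ball.
have [d d0 hd] := hdist_polar_near Hx erefl e0.
pose m := Num.min d t; have m0 : 0 < m by rewrite lt_min d0.
have md : m <= d by rewrite ge_min lexx.
have mt : m <= t by rewrite ge_min lexx orbT.
pose t1 := t - m / 2; pose t2 := t + m / 2.
have t1_0 : 0 < t1 by rewrite /t1; lra.
exists t1, t2; split; [rewrite /t1; lra|rewrite /t2; lra|].
pose E := `]t1, t2[%classic `&` f @^-1` [set~ 0].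
have mE : measurable E.
  have mf : measurable_fun (`]t1, t2[%classic : set R) f.
    apply: measurable_funS (measurable_radial rhoE mrho) => // u /=.
    by rewrite !in_itv/= andbT => /andP[h _]; rewrite ltW// (lt_trans t1_0).
  by apply: mf => //; exact: measurableC.
pose s2 := Num.min d (2 * pi).
have s20 : 0 < s2 by rewrite lt_min d0 mulr_gt0// pi_gt0.
have H : ((sinh t1 * (s2 - 0))%:E * mu E <= hvol S)%E.
  apply: hvol_ge_sector => //; first exact: ltW.
  - by rewrite ge_min lexx orbT.
  - by move=> u [/= + _]; rewrite in_itv/= => /andP[/ltW].
  - move=> u s [/= + fu]; rewrite in_itv/= => /andP[t1u ut2] /andP[s0 ss2].
    split; first exact: polar_H2.
    + move: ss2; rewrite lt_min => /andP[sd _].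
      move: t1u ut2; rewrite /t1 /t2 => t1u ut2.
      apply: hd; first by rewrite ltr_distl; apply/andP; split; lra.
      by rewrite subr0 ger0_norm.
    + rewrite rhoE; last exact: polar_H2.
      rewrite hdist_vertex_polar/=; last by rewrite ltW// (lt_trans t1_0).
      exact/eqP.
have E0 : mu E = 0%E.
  have k0 : 0 < sinh t1 * (s2 - 0).
    by rewrite subr0 pmulr_lgt0//; exact: sinh_gt0.
  have := le_trans H S0; rewrite pmule_rle0 ?lte_fin// => h.
  by apply/eqP; rewrite eq_le h measure_ge0.
exists E; split => // u /= [u12 [_ fu]]; split => //.
Qed.

Lemma radial_outside_support : {ae mu, forall t, r < t -> f t = 0}.
Proof.
apply: negligibleS (negligible_near negligible_outside_near) => t /=.
by move=> /not_implyP[rt ft]; split.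
Qed.

Variables (b0 b1 c : R).
Hypotheses (b0_ge0 : 0 <= b0) (b1_ge0 : 0 <= b1).
Hypothesis mass1 : (\int[hvol]_(x in H2) (rho x)%:E = 1)%E.
Hypothesis LambdaE :
  {ae hvol, forall x, hsupp rho x -> Lambda b0 b1 rho x = c%:E}.

Let w : R -> R := wdens f.

Let w_ge0 t : 0 <= t <= r -> 0 <= w t.
Proof. by move=> /andP[t0 _]; exact: (wdens_ge0 rhoE rho0). Qed.

Let wE : (\int[mu]_(t in `[0%R, r]) (w t)%:E = 1)%E.
Proof.
rewrite -mass1 (integral_radial_ball rhoE mrho rho0 r0)//.
exact: radial_outside_support.
Qed.

Let iw : mu.-integrable `[0, r] (EFin \o w).
Proof.
apply/integrableP; split.
  apply/measurable_EFinP; apply: measurable_funS (measurable_wdens rhoE mrho) => //.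
  by move=> u /=; rewrite !in_itv/= andbT => /andP[].
suff -> : (\int[mu]_(t in `[0%R, r]) `|(EFin \o w) t| = 1)%E by exact: ltry.
rewrite -wE; apply: eq_integral => t; rewrite inE/= in_itv/= => tr.
by rewrite ger0_norm ?w_ge0.
Qed.

Let mass_r : mass w r = 1.
Proof. by rewrite /mass /Rintegral wE. Qed.

Let P : R -> R := radial_pot r w b0 b1.

Let LambdaP x : H2 x -> 0 < hdist vertex x <= r ->
  Lambda b0 b1 rho x = (P (hdist vertex x))%:E.
Proof.
move=> Hx xr; have out := radial_outside_support.
exact: (Lambda_radial_pot rhoE mrho rho0 r0 out b0_ge0 b1_ge0 Hx iw xr).
Qed.

(** The potential takes the value [c] at radii that are dense in the support,
    since a spherical shell is not negligible. *)
Let potential_dense t1 t2 : 0 < t1 -> t1 < t2 -> t2 <= r ->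
  exists2 t, t1 < t < t2 & P t = c.
Proof.
move=> t1_0 t12 t2r; apply: contrapT => none.
have [B [mB B0 subB]] := LambdaE.
have p0 := pi_gt0 R.
have : ((sinh t1 * (2 * pi - 0))%:E * mu `]t1, t2[%classic <= hvol B)%E.
  apply: hvol_ge_sector => //.
  - by rewrite mulr_ge0// ltW.
  - by move=> u /=; rewrite in_itv/= => /andP[/ltW].
  - move=> u s /=; rewrite in_itv/= => /andP[t1u ut2] _.
    have u0 : 0 < u := lt_trans t1_0 t1u.
    have ur : u <= r by rewrite (le_trans (ltW ut2)).
    apply: subB => /= h; apply: none; exists u; first by rewrite t1u.
    have Hp : H2 (polar (u, s)) by exact: polar_H2.
    have hp : hdist vertex (polar (u, s)) = u.
      by rewrite hdist_vertex_polar//= ltW.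
    have := h; rewrite suppE /= hp LambdaP ?hp ?u0//.
    by move=> /(_ (conj Hp ur)) [].
rewrite B0 lebesgue_measure_itv/= lte_fin t12 -EFinB -EFinM lee_fin.
have k0 : 0 < 2 * pi - 0 :> R by rewrite subr0 mulr_gt0.
by rewrite leNgt pmulr_lgt0 ?subr_gt0// pmulr_lgt0// sinh_gt0.
Qed.

Let beta : R := b1 * moment r w.

Lemma b1_moment_ge0 : 0 <= beta.
Proof.
rewrite mulr_ge0// Rintegral_ge0// => t /=; rewrite in_itv/= => tr.
by rewrite mulr_ge0 ?w_ge0// ltW// cosh_gt0.
Qed.

Let mass_within : {within `[0, r], continuous (mass w)}.
Proof. exact: (mass_within_continuous r0 iw). Qed.

Let continuous_mass t : 0 < t < r -> {for t, continuous (mass w)}.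
Proof.
move=> tr; have [+ _ _] := (continuous_within_itvP _ r0).1 mass_within.
by apply; rewrite in_itv.
Qed.

(** The balance of the field and of the confinement, by differentiation of the
    constant potential. *)
Let balance t : 0 < t < r ->
  gfield t * mass w t = b0 * dlmean t + beta / 2 * sinh t.
Proof.
move=> /andP[t0 tr]; pose a := t / 2.
have a0 : 0 < a by rewrite /a; lra.
have at_ : a < t by rewrite /a; lra.
pose g s := gfield s * mass w s.
have ig : mu.-integrable `[a, r] (EFin \o g).
  exact: (integrable_gfield_mass r0 iw a0 (lexx r)).
pose F s := \int[mu]_(u in `[a, s]) g u.
have dF s : a < s < r -> is_derive s (1 : R) F (g s).
  move=> /andP[as_ sr].
  have cg : {for s, continuous g}.
    apply: cvgM; first exact: continuous_gfield (lt_trans a0 as_).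
    by apply: continuous_mass; rewrite (lt_trans a0).
  have [d1 d2] := continuous_FTC1_closed sr ig as_ cg.
  by apply: DeriveDef; [exact: d1|rewrite -derive1E; exact: d2].
pose h s := b0 * lmean (cosh s) + beta / 2 * cosh s.
have dh s : is_derive s (1 : R) h (b0 * dlmean s + beta / 2 * sinh s).
  have dl := is_derive_lmean_cosh s; have dc := is_derive_cosh s.
  by rewrite /h; apply: is_derive_eq; rewrite /GRing.scale/=; field.
pose D s := F s - h s.
have dD s : a < s < r ->
    is_derive s (1 : R) D (g s - (b0 * dlmean s + beta / 2 * sinh s)).
  by move=> asr; have := dF s asr; have := dh s => ? ?; apply: is_deriveB.
have DE s : a < s < r -> D s = P a - P s - h a.
  move=> /andP[as_ sr]; rewrite /P (radial_potB r0 iw b0 b1 a0 (ltW as_) (ltW sr)).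
  by rewrite mass_r /D /F /g /h /beta; ring.
(* the potential being [c] on a dense set, [D] is constant *)
pose K := P a - c - h a.
have DK s : a < s < r -> D s = K.
  move=> asr; apply: contrapT => /eqP; rewrite -subr_eq0 => nz.
  have cD : {for s, continuous D}.
    apply/differentiable_continuous/derivable1_diffP.
    by have [] := dD s asr.
  have cDK : (fun u => D u - K) @ s --> D s - K.
    by apply: cvgB; [exact: cD|exact: cvg_cst].
  have nearD : \forall u \near s, D u - K != 0 by exact: (cvgr_neq0 _ cDK nz).
  have [d /= d0 hd] := (nbhs_ballP _ _).1 nearD.
  have [as_ sr] := andP asr.
  pose s2 := Num.min r (s + d); have ss2 : s < s2 by rewrite lt_min sr ltrDl.
  have s2r : s2 <= r by rewrite ge_min lexx.
  have [u /andP[su us2] Pu] := potential_dense (lt_trans a0 as_) ss2 s2r.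
  have ud : u < s + d by apply: lt_le_trans us2 _; rewrite ge_min lexx orbT.
  have : D u - K != 0.
    by apply: hd; rewrite /ball/= ltr_distl; apply/andP; split; lra.
  rewrite DE ?Pu ?subrr ?eqxx//.
  by rewrite (lt_trans as_)//= (lt_le_trans us2).
have dD0 : is_derive t (1 : R) D 0.
  apply: (@near_eq_is_derive _ _ _ (cst K)).
    near=> s; rewrite DK//; apply/andP; split.
      by near: s; exact: lt_nbhsr.
    by near: s; exact: lt_nbhsl.
have [_ e1] := dD0; have [_ e2] := dD t ltac:(by rewrite at_).
by move: e2; rewrite e1 => /esym/eqP; rewrite subr_eq0 => /eqP.
Unshelve. all: by end_near. Qed.

Let mass_emass t : 0 < t < r -> mass w t = emass b0 beta t.
Proof.
move=> tr; have := balance tr; have /andP[t0 _] := tr.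
have s0 := sinh_gt0 t0; have c0 := cosh_gt0 t; have cs := cosh2_sinh2 t.
rewrite /gfield /dlmean /emass; have := pi_gt0 R.
move: (mass w t) (cosh t) (sinh t) (@pi R) s0 c0 cs => M ch sh p s0 c0 cs p0 E.
have k0 : 2 * p * sh != 0 by rewrite gt_eqF// !mulr_gt0.
have -> : M = (2 * p * sh) * ((2 * p * sh)^-1 * M) by rewrite mulVKf.
have c1 : 0 < 1 + ch by lra.
have Ec : ch - 1 = sh ^+ 2 / (1 + ch).
  by rewrite (_ : sh ^+ 2 = (ch - 1) * (1 + ch)) ?mulfK ?gt_eqF//; lra.
rewrite E (_ : ch ^+ 2 - 1 = sh ^+ 2) ?Ec; last by lra.
by field; rewrite gt_eqF.
Qed.

Lemma emass_support : emass b0 beta r = 1.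
Proof.
have [_ _ ml] := (continuous_within_itvP _ r0).1 mass_within.
have ce : emass b0 beta @ r^'- --> emass b0 beta r.
  apply: cvg_at_left_filter; apply/differentiable_continuous/derivable1_diffP.
  by have [] := is_derive_emass b0 beta r.
rewrite -mass_r; apply: (cvg_unique _ ce) => //.
apply: cvg_trans ml; apply: near_eq_cvg; near=> t.
rewrite mass_emass//; apply/andP; split.
  by near: t; exact: nbhs_left_gt.
by near: t; exact: nbhs_left_lt.
Unshelve. all: by end_near. Qed.

(** The density is the derivative of the mass. *)
Lemma radial_inside_support :
  {ae mu, forall t, 0 < t < r -> f t = b0 + beta * cosh t}.
Proof.
pose W := w \_ `[0, r].
have iW : mu.-integrable setT (EFin \o W).
  by rewrite /W -restrict_EFin; apply/integrable_restrict => //=; rewrite setTI.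
have lW : locally_integrable setT W by apply: integrable_locally.
have iWy (s : R) : mu.-integrable [set` Interval (BLeft 0) (BRight s)] (EFin \o W).
  by apply: integrableS iW.
have := FTC1 iWy lW; apply: ae_lebesgueS => t h /andP[t0 tr].
have [_ +] := h t0.
have -> : W t = w t.
  by rewrite /W patchE mem_set//= in_itv/= !ltW.
rewrite derive1E => dW.
have [_ dE] := is_derive_emass b0 beta t.
move: dW; rewrite (@near_eq_derive _ _ _ _ (emass b0 beta)) ?dE; last first.
  near=> s; have [s0 sr] : 0 < s /\ s < r.
    split; first by near: s; exact: lt_nbhsr.
    by near: s; exact: lt_nbhsl.
  rewrite -mass_emass ?s0//; apply: eq_Rintegral => u.
  rewrite inE/= in_itv/= => /andP[u0 us].
  by rewrite /W patchE mem_set//= in_itv/= u0 (le_trans us)// ltW.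
rewrite /w /wdens => /mulfI -> //.
rewrite gt_eqF// pmulr_lgt0 ?sinh_gt0// mulr_gt0//; exact: pi_gt0.
Unshelve. all: by end_near. Qed.

(** The coefficient [beta] is determined self-consistently. *)
Lemma beta_consistent : beta = b1 *
  (2 * pi * (b0 * ((cosh r ^+ 2 - 1) / 2) + beta * ((cosh r ^+ 3 - 1) / 3))).
Proof.
rewrite {1}/beta -Rintegral_emoment ?ltW//; congr (_ * _).
rewrite /moment /Rintegral; congr fine.
have c1 : continuous
    (fun t : R => 2 * pi * sinh t * (b0 + beta * cosh t) * cosh t).
  by move=> t; apply: cvgM; [exact: continuous_edens|exact: continuous_cosh].
apply: ae_eq_integral => //.
- apply/measurable_EFinP; apply: measurable_funM.
    exact: integrable_measurable iw.
  by apply: measurable_funTS; exact: measurable_cosh.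
- apply/measurable_EFinP; apply: measurable_funTS.
  exact: continuous_measurable_fun.
have n0 : {ae mu, forall t, t != 0 /\ t != r}.
  have n1 (a : R) : mu.-negligible [set a].
    by exists [set a]; split => //; exact: lebesgue_measure_set1.
  apply: negligibleS (negligibleU (n1 0) (n1 r)) => t /= /not_andP[] /negP.
    by rewrite negbK => /eqP ->; left.
  by rewrite negbK => /eqP ->; right.
have := radial_inside_support; move: n0.
apply: filterS2; first exact: (ae_filter_ringOfSetsType mu).
move=> t [t0 tr] h; rewrite /= in_itv/= => /andP[t_0 t_r].
by rewrite /w /wdens h// !lt_neqAle t_0 t_r tr eq_sym t0.
Qed.

End uniqueness.
(** * The polynomial equation *)

Section radius_equation.
Context {R : realType}.
Implicit Types x y : R.

(** The polynomial whose root is [cosh r - 1], for [r] the radius of the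
    support. *)
Definition radius_poly (b0 b1 : R) x : R :=
  1 - 2 * pi * (b0 + b1) * x - 2 * pi * b1 * x ^+ 2
    - (2 * pi * b1) / 3 * x ^+ 3 + (pi ^+ 2 * b0 * b1) / 3 * x ^+ 4.

(** The polynomial decreases as long as the coefficient of [cosh] in the density
    is nonnegative, although it may have a larger root. *)
Lemma radius_poly_decreasing (b0 b1 : R) x y :
  0 <= b0 -> 0 <= b1 -> 0 < b0 + b1 -> 0 < x -> x < y -> 2 * pi * b0 * y <= 1 ->
  radius_poly b0 b1 y < radius_poly b0 b1 x.
Proof.
move=> b00 b10 b01 x0 xy yX; rewrite /radius_poly; have := pi_gt0 R.
move: (@pi R) yX => p yX p0.
have p_b0 : 0 <= p * b0 by rewrite mulr_ge0// ltW.
have hy : p * b0 * y <= 1 / 2 by lra.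
have hx : p * b0 * x <= 1 / 2.
  by apply: le_trans hy; rewrite ler_wpM2l// ltW.
have y0 : 0 < y := lt_trans x0 xy.
rewrite -subr_gt0.
have -> : 1 - 2 * p * (b0 + b1) * x - 2 * p * b1 * x ^+ 2 -
      2 * p * b1 / 3 * x ^+ 3 + p ^+ 2 * b0 * b1 / 3 * x ^+ 4 -
    (1 - 2 * p * (b0 + b1) * y - 2 * p * b1 * y ^+ 2 -
      2 * p * b1 / 3 * y ^+ 3 + p ^+ 2 * b0 * b1 / 3 * y ^+ 4) =
  (y - x) * p * (2 * (b0 + b1) + 2 * b1 * (x + y) +
    b1 / 3 * (2 * (x ^+ 2 + x * y + y ^+ 2) -
      (x ^+ 2 * (p * b0 * x) + x ^+ 2 * (p * b0 * y) +
       y ^+ 2 * (p * b0 * x) + y ^+ 2 * (p * b0 * y)))).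
  by field.
rewrite mulr_gt0 ?mulr_gt0 ?subr_gt0//.
have q x' y' : p * b0 * y' <= 1 / 2 ->
    x' ^+ 2 * (p * b0 * y') <= x' ^+ 2 * (1 / 2).
  by move=> h; rewrite ler_wpM2l// sqr_ge0.
have h1 := q x _ hx; have h2 := q x _ hy.
have h3 := q y _ hx; have h4 := q y _ hy.
have xy0 : 0 <= x * y by rewrite mulr_ge0// ltW.
have x20 := sqr_ge0 x; have y20 := sqr_ge0 y.
have k0 : 0 <= b1 / 3 * (2 * (x ^+ 2 + x * y + y ^+ 2) -
      (x ^+ 2 * (p * b0 * x) + x ^+ 2 * (p * b0 * y) +
       y ^+ 2 * (p * b0 * x) + y ^+ 2 * (p * b0 * y))).
  by rewrite mulr_ge0 ?divr_ge0//; lra.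
have k1 : 0 <= 2 * b1 * (x + y) by rewrite !mulr_ge0//; lra.
lra.
Qed.

Lemma radius_poly_inj (b0 b1 : R) x y : 0 <= b0 -> 0 <= b1 -> 0 < b0 + b1 ->
  0 < x -> 0 < y -> 2 * pi * b0 * x <= 1 -> 2 * pi * b0 * y <= 1 ->
  radius_poly b0 b1 x = 0 -> radius_poly b0 b1 y = 0 -> x = y.
Proof.
move=> b00 b10 b01 x0 y0 hx hy px py; have [xy|yx|//] := ltgtP x y.
- by have := radius_poly_decreasing b00 b10 b01 x0 xy hy; rewrite px py ltxx.
- by have := radius_poly_decreasing b00 b10 b01 y0 yx hx; rewrite px py ltxx.
Qed.

Lemma continuous_radius_poly (b0 b1 : R) : continuous (radius_poly b0 b1).
Proof.
have cX n : continuous (fun x : R => x ^+ n) by exact: exprn_continuous.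
move=> x; apply: cvgD; last by apply: cvgM; [exact: cvg_cst|exact: cX].
apply: cvgB; last by apply: cvgM; [exact: cvg_cst|exact: cX].
apply: cvgB; last by apply: cvgM; [exact: cvg_cst|exact: cX].
by apply: cvgB; [exact: cvg_cst|apply: cvgM; [exact: cvg_cst|exact: cvg_id]].
Qed.

(** A root for which the coefficient of [cosh] in the density is
    nonnegative. *)
Lemma radius_poly_root (b0 b1 : R) : 0 <= b0 -> 0 <= b1 -> 0 < b0 + b1 ->
  exists alpha, [/\ 0 < alpha, 2 * pi * b0 * alpha <= 1 &
    radius_poly b0 b1 alpha = 0].
Proof.
move=> b00 b10 b01; have p0 := pi_gt0 R.
have P0 : radius_poly b0 b1 0 = 1.
  by rewrite /radius_poly !expr0n/= !mulr0 !subr0 addr0.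
(* the bound [X] is [(2 pi b0)^-1], or [(2 pi b1)^-1] when [b0 = 0] *)
suff [X [X0 bX PX]] : exists X, [/\ 0 < X, 2 * pi * b0 * X <= 1 &
    radius_poly b0 b1 X <= 0].
  have [] := @IVT R (radius_poly b0 b1) 0 X 0 (ltW X0).
  - exact/continuous_subspaceT/continuous_radius_poly.
  - by rewrite P0 ge_min PX orbT le_max ler01.
  move=> a; rewrite in_itv/= => /andP[a0 aX] Pa; exists a; split => //.
    rewrite lt_neqAle a0 andbT; apply/eqP => a0'.
    by move: Pa; rewrite -a0' P0 => /eqP; rewrite oner_eq0.
  by apply: le_trans bX; rewrite ler_wpM2l// !mulr_ge0// ltW.
have [b0E|b0_neq0] := eqVneq b0 0.
  have b1_gt0 : 0 < b1 by move: b01; rewrite b0E add0r.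
  exists (2 * pi * b1)^-1; split.
  - by rewrite invr_gt0 !mulr_gt0.
  - by rewrite b0E mulr0 mul0r.
  rewrite b0E /radius_poly; move: (@pi R) p0 => p p0.
  have -> : 1 - 2 * p * (0 + b1) * (2 * p * b1)^-1 -
      2 * p * b1 * (2 * p * b1)^-1 ^+ 2 -
      2 * p * b1 / 3 * (2 * p * b1)^-1 ^+ 3 +
      p ^+ 2 * 0 * b1 / 3 * (2 * p * b1)^-1 ^+ 4 =
      - ((2 * p * b1)^-1 + (2 * p * b1)^-1 ^+ 2 / 3).
    by field; rewrite !gt_eqF.
  by rewrite oppr_le0 addr_ge0// ?divr_ge0 ?exprn_ge0 ?invr_ge0 ?mulr_ge0// ltW.
have b0_gt0 : 0 < b0 by rewrite lt_neqAle eq_sym b0_neq0.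
exists (2 * pi * b0)^-1; split.
- by rewrite invr_gt0 !mulr_gt0.
- by rewrite divff// gt_eqF// !mulr_gt0.
rewrite /radius_poly; move: (@pi R) p0 => p p0.
have -> : 1 - 2 * p * (b0 + b1) * (2 * p * b0)^-1 -
    2 * p * b1 * (2 * p * b0)^-1 ^+ 2 -
    2 * p * b1 / 3 * (2 * p * b0)^-1 ^+ 3 +
    p ^+ 2 * b0 * b1 / 3 * (2 * p * b0)^-1 ^+ 4 =
    - (b1 / b0 + b1 / b0 / b0 * (2 * p)^-1 + b1 / b0 ^+ 3 / p ^+ 2 / 16).
  by field; rewrite !gt_eqF.
rewrite oppr_le0 !addr_ge0 ?mulr_ge0 ?invr_ge0 ?mulr_ge0 ?exprn_ge0//; exact: ltW.
Qed.

End radius_equation.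

Section uniqueness_of_equilibrium.
Context {R : realType}.
Notation mu := (@lebesgue_measure R).

Lemma radial_equilibrium_unique (b0 b1 alpha : R) (rho : R * R * R -> R) :
  0 <= b0 -> 0 <= b1 -> 0 < b0 + b1 -> 0 < alpha -> 2 * pi * b0 * alpha <= 1 ->
  radius_poly b0 b1 alpha = 0 -> radial_equilibrium b0 b1 rho ->
  {ae hvol, forall x : R * R * R,
     H2 x -> rho x = rhot_m b0 alpha (hdist vertex x)}.
Proof.
move=> b00 b10 b01 a0 ba Pa.
move=> [[[mrho rho0 mass1] [c LambdaE]] [f rhoE] [r r0 suppE]].
have p0 := pi_gt0 R.
pose beta := b1 * moment r (wdens f).
have beta0 : 0 <= beta by exact: (b1_moment_ge0 r rhoE rho0 b10).
have cr1 := cosh_gt1 r0.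
have [a aE] : exists a, cosh r = a + 1 by exists (cosh r - 1); rewrite subrK.
have a_gt0 : 0 < a by move: cr1; rewrite aE; lra.
have e1 : emass b0 beta r = 1.
  exact: (emass_support rhoE mrho rho0 r0 suppE b00 b10 mass1 LambdaE).
have e2 := beta_consistent rhoE mrho rho0 r0 suppE b00 b10 mass1 LambdaE.
rewrite -/beta in e2.
have inn := radial_inside_support rhoE mrho rho0 r0 suppE b00 b10 mass1 LambdaE.
rewrite -/beta in inn; clearbody beta.
have e1' : 2 * pi * b0 * a + beta * (pi * a * (a + 2)) = 1.
  by rewrite -[RHS]e1 /emass aE; move: (@pi R) => p; field.
have betaE : beta = (1 - 2 * pi * b0 * a) / (pi * a * (a + 2)).
  rewrite -[X in X - _]e1' addrAC subrr add0r mulfK// gt_eqF// !mulr_gt0//.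
  by rewrite addr_gt0.
have baa : 2 * pi * b0 * a <= 1.
  by rewrite -[leRHS]e1' lerDl mulr_ge0// ltW// !mulr_gt0// addr_gt0.
have Paa : radius_poly b0 b1 a = 0.
  move: e2; rewrite aE betaE /radius_poly; move: (@pi R) p0 => p p0.
  move=> /eqP; rewrite -subr_eq0 => /eqP e.
  transitivity (p * a * (a + 2) * 0); last by rewrite mulr0.
  by rewrite -[in RHS]e; field; rewrite !gt_eqF// addr_gt0.
have aa : alpha = a by exact: (radius_poly_inj b00 b10 b01 a0 a_gt0 ba baa Pa Paa).
have rE : acosh (alpha + 1) = r by rewrite aa -aE coshK// ltW.
have fE : {ae mu, forall t, 0 <= t -> f t = rhot_m b0 alpha t}.
  have out := radial_outside_support rhoE mrho r0 suppE.
  have n1 (u : R) : mu.-negligible [set u].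
    by exists [set u]; split => //; exact: lebesgue_measure_set1.
  apply: negligibleS (negligibleU (negligibleU (n1 0) (n1 r)) (negligibleU out inn)).
  move=> t /= /not_implyP[t0 ne].
  have [->|tn0] := eqVneq t 0; first by left; left.
  have [->|tnr] := eqVneq t r; first by left; right.
  right; have [tr|rt] := ltP t r; [right|left] => h; apply: ne.
    rewrite h; last by rewrite lt_neqAle eq_sym tn0 t0.
    by rewrite /rhot_m rE (ltW tr) aa -betaE.
  have rt' : r < t by rewrite lt_neqAle eq_sym tnr.
  by rewrite h// /rhot_m rE leNgt rt'.
have := ae_radial fE; apply: filterS => x h Hx; rewrite rhoE//; exact: h.
Qed.

End uniqueness_of_equilibrium.

Theorem proposition5p1 (R : realType) (b0 b1 : R)
    (b0_ge0 : 0 <= b0) (b1_ge0 : 0 <= b1) (b01_neq0 : (b0, b1) <> (0, 0)) :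
  exists alpha : R,
    [/\ 0 < alpha,
        1 - 2 * pi * (b0 + b1) * alpha - 2 * pi * b1 * alpha ^+ 2
          - (2 * pi * b1) / 3 * alpha ^+ 3
          + (pi ^+ 2 * b0 * b1) / 3 * alpha ^+ 4 = 0,
        radial_equilibrium b0 b1
          (fun x : R * R * R => rhot_m b0 alpha (hdist vertex x)) &
        forall rho : R * R * R -> R, radial_equilibrium b0 b1 rho ->
          {ae hvol, forall x : R * R * R,
             H2 x -> rho x = rhot_m b0 alpha (hdist vertex x)}].
Proof.
have b01 : 0 < b0 + b1.
  rewrite lt_neqAle addr_ge0// andbT eq_sym paddr_eq0//.
  by apply/negP => /andP[/eqP b00 /eqP b10]; apply: b01_neq0; rewrite b00 b10.
have [alpha [a0 ba Pa]] := radius_poly_root b0_ge0 b1_ge0 b01.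
exists alpha; split => //.
- have p0 := pi_gt0 R.
  have k0 : 0 < pi * alpha * (alpha + 2) by rewrite !mulr_gt0// addr_gt0.
  have beta0 : 0 <= (1 - 2 * pi * b0 * alpha) / (pi * alpha * (alpha + 2)).
    by rewrite divr_ge0 ?subr_ge0// ltW.
  apply: rho_radial_equilibrium => //.
  have [b0E|b0n] := eqVneq b0 0.
    by rewrite b0E mulr0 mul0r subr0 add0r mul1r invr_eq0 gt_eqF.
  rewrite gt_eqF// -[ltLHS]addr0 ltr_leD//.
  by rewrite lt_neqAle eq_sym b0n.
- by move=> rho; exact: radial_equilibrium_unique.
Qed.
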